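(* Let $0<\rho<1$, let $(r_k)_{k\in\mathbb{N}}$ be an increasing sequence of positive numbers tending to infinity and let $(n_k)_{k\in\mathbb{N}}$ be a sequence of natural numbers satisfying $n_k\sim r_k^\rho$ as $k\to\infty$. If $(r_k)$ tends to $\infty$ sufficiently fast, then $$f(z)=\prod_{k=1}^\infty\left(1-\left(\frac{z}{r_k}\right)^{n_k}\right)$$ defines an entire function $f$ of order $\rho$ and lower order $0$ which has the following properties: the zeros of $f$ form a sequence $(z_m)_{m\in\mathbb{N}}$ of distinct points in $\mathbb{C}\setminus\{0\}$ which tends to $\infty$ and whose exponent of convergence is less than $1$; one has $$f(z)=\prod_{m=1}^\infty\left(1-\frac{z}{z_m}\right);$$ and there exists $C>0$ such that $$\left|\frac{f''(z_m)}{f'(z_m)^2}\right|\le C\quad\text{for all }m\in\mathbb{N}.$$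
   Context: For an entire function $f$ let $M(r,f)=\max_{|z|=r}|f(z)|$. The order of $f$ is $\limsup_{r\to\infty}\frac{\log\log M(r,f)}{\log r}$ and the lower order of $f$ is $\liminf_{r\to\infty}\frac{\log\log M(r,f)}{\log r}$. The exponent of convergence of a sequence $(z_m)$ in $\mathbb{C}\setminus\{0\}$ tending to $\infty$ is $\inf\{t>0:\sum_m|z_m|^{-t}<\infty\}$. The notation $n_k\sim r_k^\rho$ means $n_k/r_k^\rho\to1$ as $k\to\infty$. Natural numbers are positive integers. *)

(* Defs.v *)
From HB Require Import structures.
From mathcomp Require Import all_boot all_order all_algebra complex.
From mathcomp Require Import all_classical all_reals all_analysis.

Set Implicit Arguments.
Unset Strict Implicit.
Unset Printing Implicit Defensive.

Import Order.TTheory GRing.Theory Num.Theory.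
Import numFieldTopology.Exports numFieldNormedType.Exports.

Local Open Scope classical_set_scope.
Local Open Scope ring_scope.
Local Open Scope complex_scope.

(* The instances above are keyed on abstract number fields and are not found on
   the concrete type R[i].  The topology copied here is the one of the complex
   modulus, and R[i] is normed over itself, so that [derivable f z 1] and
   [derive1 f] are complex differentiability and the complex derivative. *)
HB.instance Definition _ (R : rcfType) :=
  PseudoPointedMetric.copy R[i] R[i]^o.
HB.instance Definition _ (R : rcfType) := NormedModule.copy R[i] R[i]^o.

(* Real-valued modulus; the generic norm `|z| is (cmod z)%:C, of type R[i]. *)
Definition cmod (R : rcfType) (z : R[i]) : R := ComplexField.Normc.normc z.

Definition entire (R : realType) (f : R[i] -> R[i]) : Prop :=
  forall z, derivable f z 1.

(* For entire f and r >= 0 the supremum is attained and finite. *)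
Definition max_modulus (R : realType) (f : R[i] -> R[i]) (r : R) : R :=
  sup [set cmod (f z) | z in [set z | cmod z = r]].

(* [ln] is 0 on nonpositive reals; for nonconstant entire f this affects only
   bounded values of r, hence neither the limsup nor the liminf at +oo. *)
Definition loglog_ratio (R : realType) (f : R[i] -> R[i]) (r : R) : \bar R :=
  (ln (ln (max_modulus f r)) / ln r)%:E.

Definition order_of_growth (R : realType) (f : R[i] -> R[i]) : \bar R :=
  limf_esup (loglog_ratio f) (pinfty_nbhs R).

Definition lower_order_of_growth (R : realType) (f : R[i] -> R[i]) : \bar R :=
  limf_einf (loglog_ratio f) (pinfty_nbhs R).

(* Convergence of an infinite product in the usual sense of complex analysis:
   after removal of finitely many factors (which may vanish), the partial
   products tend to a nonzero limit. *)
Definition infprod_cvg_to (R : realType) (a : nat -> R[i]) (p : R[i]) : Prop :=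
  exists N : nat, exists q : R[i],
    [/\ q != 0,
        (\prod_(N <= k < n) a k) @[n --> \oo] --> q
      & p = (\prod_(0 <= k < N) a k) * q].

(* Extended-real infimum, so that it is +oo when no exponent works. *)
Definition exponent_of_convergence (R : realType) (z : nat -> R[i]) : \bar R :=
  ereal_inf [set t%:E | t in
    [set t : R | 0 < t /\
       (\sum_(0 <= m <oo) (cmod (z m) `^ (- t))%:E < +oo)%E]].

(* Main.v *)
Require Import Defs.
From HB Require Import structures.
From mathcomp Require Import all_boot all_order all_algebra complex.
From mathcomp Require Import all_classical all_reals all_analysis.
From mathcomp Require Import separable cyclotomic ring lra zify.

Set Implicit Arguments.
Unset Strict Implicit.
Unset Printing Implicit Defensive.

Import Order.TTheory GRing.Theory Num.Theory.
Import numFieldTopology.Exports numFieldNormedType.Exports.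

Local Open Scope classical_set_scope.
Local Open Scope ring_scope.
Local Open Scope complex_scope.

(* The radii grow so fast that on |z| = r_k the factors with index j < k are
   dominated by (r_k/r_j)^(n_j) and the product of those with j > k is close
   to 1.  Hence log M(r, f) is at most N log r for r_k <= r <= r_(k+1), with
   N = n_1 + ... + n_k = O(r_k^rho), and at least n_k for r = 8 r_k: this gives
   order rho, and lower order 0 along r = exp(r_k).  Let z be a zero on
   |z| = r_k and H the product of the factors other than the k-th one, so that
   z f' = - n_k H and z^2 f'' = - n_k ((n_k - 1) H + 2 z H') at z.  Since |H| is
   bounded below and z H'/H = O(n_k), the quotient f''/f'^2 is bounded.
   The derivatives of f are obtained as limits of those of the partial
   products, which are polynomials whose coefficients are dominated by those of
   the products of the 1 + (X/r_k)^(n_k). *)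

(** * Complex modulus, convergence and differentiability *)

(** Every estimate is made on a partial product, with a constant independent of the number of
    factors, and only then carried to the limit; thus H is always a finite product. In f''/f'^2 =
    z^2 f''/(z f')^2 the powers of z and n_k cancel, which leaves at most (1 + 2|zH'/H|/n_k)/|H|.
    The inner circles enter zH'/H through n_1 + ... + n_(k-1), which must be O(n_k): hence the
    eventual doubling of n_k. The outer circles contribute a bounded amount however large their
    exponents are. The ratio 64 = 8 * 8 keeps the circle of radius 8 r_k well inside the next one,
    and 8 is chosen because half of 8^n still exceeds e^n. The growth conditions are available only
    from an index K on; the earlier circles merely change constants. *)

Lemma cmodE (R : rcfType) (z : R[i]) : `|z| = (cmod z)%:C.
Proof. by []. Qed.

Lemma cmod_ge0 (R : rcfType) (z : R[i]) : 0 <= cmod z.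
Proof. by rewrite -lecR -cmodE normr_ge0. Qed.

Lemma cmodM (R : rcfType) (z w : R[i]) : cmod (z * w) = cmod z * cmod w.
Proof. exact: ComplexField.Normc.normcM. Qed.

Lemma cmodV (R : rcfType) (z : R[i]) : cmod z^-1 = (cmod z)^-1.
Proof. exact: ComplexField.Normc.normcV. Qed.

Lemma cmod0 (R : rcfType) : cmod (0 : R[i]) = 0.
Proof. exact: ComplexField.Normc.normc0. Qed.

Lemma cmod1 (R : rcfType) : cmod (1 : R[i]) = 1.
Proof. exact: ComplexField.Normc.normc1. Qed.

Lemma cmod_eq0 (R : rcfType) (z : R[i]) : (cmod z == 0) = (z == 0).
Proof.
apply/eqP/eqP => [/ComplexField.Normc.eq0_normc //|->]; exact: cmod0.
Qed.

Lemma cmod_gt0 (R : rcfType) (z : R[i]) : (0 < cmod z) = (z != 0).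
Proof. by rewrite lt_def cmod_ge0 andbT cmod_eq0. Qed.

Lemma cmodN (R : rcfType) (z : R[i]) : cmod (- z) = cmod z.
Proof. exact: normcN. Qed.

Lemma cmodX (R : rcfType) (z : R[i]) n : cmod (z ^+ n) = cmod z ^+ n.
Proof. by elim: n => [|n IH]; rewrite ?expr0 ?cmod1 // !exprS cmodM IH. Qed.

Lemma cmodC (R : rcfType) (x : R) : cmod x%:C = `|x|.
Proof. by rewrite /cmod /= expr0n addr0 sqrtr_sqr. Qed.

Lemma cmodnat (R : rcfType) n : cmod (n%:R : R[i]) = n%:R.
Proof.
have -> : (n%:R : R[i]) = (n%:R)%:C by rewrite rmorph_nat.
by rewrite cmodC normr_nat.
Qed.

Lemma cmodD (R : rcfType) (z w : R[i]) : cmod (z + w) <= cmod z + cmod w.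
Proof. exact: le_normcD. Qed.

Lemma cmodB (R : rcfType) (z w : R[i]) : cmod (z - w) <= cmod z + cmod w.
Proof. by rewrite -(cmodN w) cmodD. Qed.

Lemma cmodBC (R : rcfType) (z w : R[i]) : cmod (z - w) = cmod (w - z).
Proof. by rewrite -cmodN opprB. Qed.

Lemma cmodB_ge (R : rcfType) (z w : R[i]) : cmod z - cmod w <= cmod (z - w).
Proof. by rewrite lerBlDr -{1}(subrK w z) cmodD. Qed.

Lemma cmod_prod (R : rcfType) (I : Type) (s : seq I) (P : pred I) (F : I -> R[i]) :
  cmod (\prod_(i <- s | P i) F i) = \prod_(i <- s | P i) cmod (F i).
Proof. by apply: (big_morph (@cmod R) (@cmodM R) (@cmod1 R)). Qed.

Lemma cmod_sum (R : rcfType) (I : Type) (s : seq I) (P : pred I) (F : I -> R[i]) :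
  cmod (\sum_(i <- s | P i) F i) <= \sum_(i <- s | P i) cmod (F i).
Proof.
elim/big_rec2 : _ => [|i y x _ IH]; first by rewrite cmod0.
by apply: le_trans (cmodD _ _) _; rewrite lerD2l.
Qed.

Lemma cmod_Re (R : rcfType) (z : R[i]) : `|complex.Re z| <= cmod z.
Proof. by rewrite -lecR; exact: (normc_ge_Re z). Qed.

Lemma cmod_Im (R : rcfType) (z : R[i]) : `|complex.Im z| <= cmod z.
Proof.
case: z => a b /=; rewrite /cmod /= -sqrtr_sqr ler_sqrt ?lerDr ?sqr_ge0 //.
by rewrite addr_ge0 ?sqr_ge0.
Qed.

Lemma cmod_ReIm (R : rcfType) (z : R[i]) :
  cmod z <= `|complex.Re z| + `|complex.Im z|.
Proof.
rewrite {1}(complexE z); apply: le_trans (cmodD _ _) _.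
rewrite cmodM !cmodC lerD2l.
suff -> : cmod ('i : R[i]) = 1 by rewrite mul1r.
by rewrite /cmod /= expr0n expr1n add0r sqrtr1.
Qed.

(** The positive elements of [R[i]] are exactly the positive reals, so [e] can be taken real. *)
Lemma ccvgP (R : realType) (T : Type) (F : set_system T) (FF : Filter F)
    (u : T -> R[i]) (l : R[i]) :
  u x @[x --> F] --> l <->
  forall e : R, 0 < e -> \forall x \near F, cmod (l - u x) <= e.
Proof.
rewrite cvgrPdist_le; split=> H e e0.
  have := H e%:C; rewrite ltcR => /(_ e0); apply: filterS => x.
  by rewrite cmodE lecR.
case: e e0 => a b; rewrite ltcE /= => /andP[/eqP -> a0].
move: a0 => /H; apply: filterS => x.
by rewrite cmodE lecR.
Qed.

Lemma cmod_cvg_le (R : realType) (T : Type) (F : set_system T) (FF : ProperFilter F)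
    (u : T -> R[i]) (l : R[i]) (B : R) :
  u x @[x --> F] --> l -> (\forall x \near F, cmod (u x) <= B) -> cmod l <= B.
Proof.
move=> /ccvgP ul uB; apply/ler_addgt0Pr => e e0.
have [x [h1 h2]] : exists x, cmod (l - u x) <= e /\ cmod (u x) <= B.
  by apply: (@filter_ex _ F); apply: filterI; [exact: ul|exact: uB].
by rewrite -[l](subrK (u x)) addrC; apply: le_trans (cmodD _ _) _;
  rewrite addrC [B + e]addrC lerD.
Qed.

Lemma cmod_cvg_ge (R : realType) (T : Type) (F : set_system T) (FF : ProperFilter F)
    (u : T -> R[i]) (l : R[i]) (B : R) :
  u x @[x --> F] --> l -> (\forall x \near F, B <= cmod (u x)) -> B <= cmod l.
Proof.
move=> /ccvgP ul uB; apply/ler_addgt0Pr => e e0.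
have [x [h1 h2]] : exists x, cmod (l - u x) <= e /\ B <= cmod (u x).
  by apply: (@filter_ex _ F); apply: filterI; [exact: ul|exact: uB].
have := cmodB_ge (u x) (u x - l); rewrite subKr => h3.
rewrite cmodBC in h1; lra.
Qed.

Lemma complex_hausdorff (R : realType) : hausdorff_space R[i].
Proof. exact: (@norm_hausdorff _ R[i]). Qed.

(* Both Re u + v and Im u + v are nondecreasing and bounded. *)
Lemma complex_cvg_majorant (R : realType) (u : nat -> R[i]) (v : nat -> R) (B : R) :
  (forall n, cmod (u n.+1 - u n) <= v n.+1 - v n) -> (forall n, v n <= B) ->
  exists l : R[i], u n @[n --> \oo] --> l.
Proof.
move=> uv vB.
have cvg_part (g : nat -> R) : (forall n, `|g n.+1 - g n| <= v n.+1 - v n) ->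
    cvgn g.
  move=> gv.
  have vhomo : {homo v : n m / (n <= m)%N >-> n <= m}.
    apply: homo_leq => // [x y z|n]; first exact: le_trans.
    by rewrite -subr_ge0 (le_trans _ (gv n)).
  have cv : cvgn v.
    by apply: nondecreasing_is_cvgn => //; exists B => _ [n _ <-].
  have gvhomo : {homo (fun n => g n + v n) : n m / (n <= m)%N >-> n <= m}.
    apply: homo_leq => // [x y z|n]; first exact: le_trans.
    by have := gv n; rewrite ler_norml => /andP[+ _]; lra.
  have gb n : g n <= g 0 + v n - v 0%N.
    elim: n => [|n IH]; first by rewrite addrK.
    by have := gv n; rewrite ler_norml => /andP[_]; lra.
  have cgv : cvgn (fun n => g n + v n).
    apply: nondecreasing_is_cvgn => //; exists (g 0%N + B - v 0%N + B) => _ [n _ <-].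
    by have := gb n; have := vB n; lra.
  have -> : g = (fun n => (g n + v n) - v n).
    by apply/funext => n; rewrite addrK.
  exact: is_cvgB.
have /cvg_ex[a ha] := cvg_part (fun n => complex.Re (u n)) (fun n =>
  le_trans (eq_ind _ (fun x => `|x| <= _) (cmod_Re (u n.+1 - u n)) _ (raddfB _ _ _))
    (uv n)).
have /cvg_ex[b hb] := cvg_part (fun n => complex.Im (u n)) (fun n =>
  le_trans (eq_ind _ (fun x => `|x| <= _) (cmod_Im (u n.+1 - u n)) _ (raddfB _ _ _))
    (uv n)).
exists (a +i* b); apply/ccvgP => e e0.
have e20 : 0 < e / 2 by lra.
move/cvgrPdist_le/(_ _ e20) : ha => ha; move/cvgrPdist_le/(_ _ e20) : hb => hb.
near=> n; apply: le_trans (cmod_ReIm _) _; rewrite (splitr e).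
rewrite !raddfB /=; apply: lerD; by near: n.
Unshelve. all: by end_near.
Qed.

(** The difference quotient is within [B * cmod h] of [d]. A quadratic remainder is the form of
    differentiability that survives a pointwise limit. *)
Lemma is_derive_quadratic (R : realType) (f : R[i] -> R[i]) (z d : R[i]) (B : R) :
  (forall w, cmod (w - z) <= 1 ->
     cmod (f w - f z - d * (w - z)) <= B * cmod (w - z) ^+ 2) ->
  is_derive z 1 f d.
Proof.
move=> H.
have B0 : 0 <= B.
  have := H (z + 1); rewrite (_ : z + 1 - z = 1); last by ring.
  by rewrite cmod1 expr1n !mulr1 => /(_ (lexx _)); exact: le_trans (cmod_ge0 _).
have cv : h^-1 *: ((f \o shift z) (h *: (1 : R[i])) - f z) @[h --> 0^'] --> d.
  apply/ccvgP => e e0.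
  (* [B] may be 0, hence the division by [B + 1]. *)
  have m0 : 0 < Num.min 1 (e / (B + 1)) by rewrite lt_min ltr01 divr_gt0 //; lra.
  exists (Num.min 1 (e / (B + 1)))%:C; first by rewrite /= ltcR.
  move=> h /=; rewrite sub0r normrN cmodE ltcR lt_min => /andP[h1 h2] hn0.
  have h0 : 0 < cmod h by rewrite cmod_gt0.
  have := H (h + z); rewrite addrK => /(_ (ltW h1)) H2.
  change (cmod (d - h^-1 * (f (h * 1 + z) - f z)) <= e); rewrite mulr1.
  have -> : d - h^-1 * (f (h + z) - f z) = - (h^-1 * (f (h + z) - f z - d * h)).
    by field.
  rewrite cmodN cmodM cmodV.
  rewrite ler_pdivrMl //; apply: le_trans H2 _.
  rewrite expr2 mulrA [leRHS]mulrC ler_pM2r //.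
  move: h2; rewrite ltr_pdivlMr; last by lra.
  by nra.
have dv : derivable f z 1 by apply/cvg_ex; exists d.
exact: (DeriveDef dv (cvg_lim (@complex_hausdorff R) cv)).
Qed.

(** * Limits of polynomials with a common majorant *)

(** Coefficientwise majorant: bounds on the disc of radius [A] for [p] and all its derivatives
    reduce to values at [A] of real polynomials with nonnegative coefficients. *)
Definition majorized (R : rcfType) (p : {poly R[i]}) (q : {poly R}) :=
  forall i, cmod p`_i <= q`_i.

Lemma majorized_ge0 (R : rcfType) (p : {poly R[i]}) (q : {poly R}) i :
  majorized p q -> 0 <= q`_i.
Proof. by move=> /(_ i); apply: le_trans; exact: cmod_ge0. Qed.

Lemma majorizedD (R : rcfType) (p p' : {poly R[i]}) (q q' : {poly R}) :
  majorized p q -> majorized p' q' -> majorized (p + p') (q + q').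
Proof. by move=> h h' i; rewrite !coefD (le_trans (cmodD _ _)) // lerD. Qed.

Lemma majorizedN (R : rcfType) (p : {poly R[i]}) (q : {poly R}) :
  majorized p q -> majorized (- p) q.
Proof. by move=> h i; rewrite coefN cmodN. Qed.

Lemma majorizedM (R : rcfType) (p p' : {poly R[i]}) (q q' : {poly R}) :
  majorized p q -> majorized p' q' -> majorized (p * p') (q * q').
Proof.
move=> h h' i; rewrite !coefM (le_trans (cmod_sum _ _ _)) // ler_sum // => j _.
by rewrite cmodM ler_pM ?cmod_ge0.
Qed.

Lemma majorized_deriv (R : rcfType) (p : {poly R[i]}) (q : {poly R}) :
  majorized p q -> majorized p^`() q^`().
Proof.
move=> h i; rewrite !coef_deriv -mulr_natr cmodM cmodnat mulr_natr.
by rewrite lerMn2r h orbT.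
Qed.

Lemma majorized_derivn (R : rcfType) (p : {poly R[i]}) (q : {poly R}) d :
  majorized p q -> majorized p^`(d) q^`(d).
Proof. by move=> h; elim: d => // d IH; rewrite !derivnS; exact: majorized_deriv. Qed.

Lemma majorized_horner (R : rcfType) (p : {poly R[i]}) (q : {poly R}) z A :
  majorized p q -> cmod z <= A -> cmod p.[z] <= q.[A].
Proof.
move=> h zA; set n := maxn (size p) (size q).
rewrite (@horner_coef_wide _ n p) ?leq_maxl // (@horner_coef_wide _ n q) ?leq_maxr //.
rewrite (le_trans (cmod_sum _ _ _)) // ler_sum // => i _.
by rewrite cmodM cmodX ler_pM ?cmod_ge0 ?exprn_ge0 ?cmod_ge0 // lerXn2r //
  nnegrE ?cmod_ge0 // (le_trans (cmod_ge0 z)).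
Qed.

(** Since i <= 2^i, the sum of the i q_i A^i is at most q(2A). This plays the part of Cauchy's
    estimate: a derivative costs a doubling of the radius. *)
Lemma nneg_horner_deriv (R : realFieldType) (q : {poly R}) A :
  (forall i, 0 <= q`_i) -> 0 < A -> q^`().[A] <= q.[A *+ 2] / A.
Proof.
move=> q0 A0; rewrite ler_pdivlMr //.
set n := maxn (size q) (size (q^`() * 'X)).
have -> : q^`().[A] * A = (q^`() * 'X).[A] by rewrite hornerMX.
rewrite (@horner_coef_wide _ n q) ?leq_maxl //
  (@horner_coef_wide _ n (_ * 'X)) ?leq_maxr //.
apply: ler_sum => i _; rewrite coefMX -mulr_natr exprMn [_ * 2%:R ^+ i]mulrC mulrA.
rewrite ler_wpM2r ?exprn_ge0 ?(ltW A0) //.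
case: (val i) => [|k] /=; first by rewrite expr0 mulr1.
rewrite coef_deriv -[leLHS]mulr_natr ler_wpM2l // -natrX ler_nat ltnW //.
exact: ltn_expl.
Qed.

(** Induction along Horner's scheme: if T is the remainder of p, that of pX + c is w T + p'(z) (w -
    z)^2, and the majorant obeys the matching rule (qX + b)'' = X q'' + 2 q'. *)
Lemma taylor_remainder (R : rcfType) (p : {poly R[i]}) (q : {poly R}) z w A :
  majorized p q -> cmod z <= A -> cmod w <= A ->
  cmod (p.[w] - p.[z] - p^`().[z] * (w - z)) <= q^`(2).[A] * cmod (w - z) ^+ 2.
Proof.
move=> pq zA wA; have A0 : 0 <= A := le_trans (cmod_ge0 z) zA.
elim/poly_ind: p q pq => [|p c IH] q pq.
  rewrite deriv0 !horner0 subrr mul0r subrr cmod0 mulr_ge0 ?exprn_ge0 ?cmod_ge0 //.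
  have : majorized (0 : {poly R[i]})^`(2) q^`(2) by exact: majorized_derivn.
  by move/majorized_horner => /(_ 0 A); rewrite cmod0 => /(_ A0); apply: le_trans;
    exact: cmod_ge0.
have [q1 [b qE]] : exists q1 b, q = q1 * 'X + b%:P.
  by elim/poly_ind: q {pq} => [|q b _]; [exists 0, 0; rewrite mul0r addr0|exists q, b].
move: qE pq => -> {q}; move: q1 => q pq.
have {}pq : majorized p q.
  by move=> i; have := pq i.+1; rewrite !coefD !coefMX !coefC /= !addr0.
have := IH _ pq; set T := p.[w] - _ - _ => hT.
have -> : (p * 'X + c%:P).[w] - (p * 'X + c%:P).[z] - (p * 'X + c%:P)^`().[z] * (w - z)
    = w * T + p^`().[z] * (w - z) ^+ 2.
  by rewrite /T derivMXaddC !(hornerD, hornerMX, hornerC); ring.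
have -> : (q * 'X + b%:P)^`(2).[A] = A * q^`(2).[A] + q^`().[A] *+ 2.
  by rewrite !derivnS derivn0 derivMXaddC derivD derivM derivX mulr1 !(hornerD,
    hornerMX, hornerC); ring.
apply: le_trans (cmodD _ _) _;
  rewrite cmodM [cmod (_ * _ ^+ 2)]cmodM cmodX mulrDl lerD //.
  by rewrite -mulrA ler_pM ?cmod_ge0.
rewrite ler_wpM2r ?exprn_ge0 ?cmod_ge0 //.
have h := majorized_horner (majorized_deriv pq) zA.
by rewrite mulr2n (le_trans h) // lerDl (le_trans (cmod_ge0 _) h).
Qed.

(* If p n.+1 - p n is majorized by q n.+1 - q n, with q n bounded on every
   disc, then telescoping makes all derivatives of p n converge pointwise. *)
Section LimitOfPolynomials.
Variables (R : realType) (p : nat -> {poly R[i]}) (q : nat -> {poly R}).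
Hypothesis pq0 : majorized (p 0%N) (q 0%N).
Hypothesis pqS : forall n, majorized (p n.+1 - p n) (q n.+1 - q n).
Hypothesis q_bounded : forall A, 0 < A -> exists B, forall n, (q n).[A] <= B.

Lemma majorized_seq n : majorized (p n) (q n).
Proof.
elim: n => // n IH; rewrite -(subrK (p n) (p n.+1)) -(subrK (q n) (q n.+1)).
exact: majorizedD.
Qed.

Lemma derivn_bounded d A : 0 < A -> exists B, forall n, (q n)^`(d).[A] <= B.
Proof.
elim: d A => [|d IH] A A0; first exact: q_bounded.
have [|B hB] := IH (A *+ 2); first by rewrite mulrn_wgt0.
exists (B / A) => n; rewrite derivnS; apply: le_trans (nneg_horner_deriv _ A0) _.
  by move=> i; exact/majorized_ge0/majorized_derivn/majorized_seq.
by rewrite ler_wpM2r // invr_ge0 ltW.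
Qed.

Lemma cvg_derivn d z : exists l : R[i], (p n)^`(d).[z] @[n --> \oo] --> l.
Proof.
have A0 : 0 < cmod z + 1 by rewrite ltr_wpDl ?cmod_ge0.
have [B hB] := derivn_bounded d A0.
apply: (@complex_cvg_majorant _ _ (fun n => (q n)^`(d).[cmod z + 1]) B) => // n.
rewrite -!hornerN -!hornerD -!derivnB.
by apply: majorized_horner; [exact: majorized_derivn|rewrite lerDl].
Qed.

Definition limit_derivn (d : nat) (z : R[i]) : R[i] := sval (cid (cvg_derivn d z)).

Lemma limit_derivnP (d : nat) (z : R[i]) : (p n)^`(d).[z] @[n --> \oo] -->
  limit_derivn d z.
Proof. by rewrite /limit_derivn; case: cid. Qed.

(** The Taylor remainder is bounded uniformly in [n] on the disc of radius |z| + 1, which contains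
    every [w] within 1 of [z], so the bound passes to the limit. *)
Lemma is_derive_limit (d : nat) (z : R[i]) : is_derive z 1 (limit_derivn d)
  (limit_derivn d.+1 z).
Proof.
have A0 : 0 < cmod z + 1 by rewrite ltr_wpDl ?cmod_ge0.
have [B hB] := derivn_bounded d.+2 A0.
apply: (@is_derive_quadratic _ _ _ _ B) => w wz.
have wA : cmod w <= cmod z + 1.
  by rewrite -[w](subrK z) addrC (le_trans (cmodD _ _)) // lerD2l.
apply: (@cmod_cvg_le _ _ \oo _ (fun n => (p n)^`(d).[w] - (p n)^`(d).[z]
   - (p n)^`(d.+1).[z] * (w - z))).
  apply: cvgB; first by apply: cvgB; exact: limit_derivnP.
  by apply: cvgM; [exact: limit_derivnP|exact: cvg_cst].
apply: nearW => n; rewrite derivnS.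
have h : majorized (p n)^`(d) (q n)^`(d) by exact/majorized_derivn/majorized_seq.
apply: le_trans (taylor_remainder h _ wA) _; first by rewrite lerDl.
by rewrite ler_wpM2r ?exprn_ge0 ?cmod_ge0 //; have := hB n; rewrite !derivnS.
Qed.

End LimitOfPolynomials.

(** * Infinite products *)

Lemma summable_tail (R : realType) (t : nat -> R) (B e : R) :
  (forall k, 0 <= t k) -> (forall n, \sum_(0 <= k < n) t k <= B) -> 0 < e ->
  exists N, forall n, \sum_(N <= k < n) t k <= e.
Proof.
move=> t0 tB e0; pose s n := \sum_(0 <= k < n) t k.
have hs : has_sup (range s) by split; [exists (s 0%N), 0%N|exists B => _ [n _ <-];
  exact: tB].
have [_ [N _ <-] hN] := sup_adherent e0 hs; exists N => n.
have [nN|/ltnW nN] := leqP n N; first by rewrite big_geq // ltW.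
have : s n <= sup (range s) by apply: ub_le_sup; [exact: hs.2|exists n].
rewrite /s (@big_cat_nat _ _ _ N) //= -/(s N) => h; lra.
Qed.

(** Weierstrass inequality, from (1 - S)(1 - x) >= 1 - S - x; once S + x reaches 1 the bound is
    trivial. *)
Lemma cmod_prod1B_ge (R : realType) (a : nat -> R[i]) (N n : nat) :
  1 - \sum_(N <= k < n) cmod (a k) <= cmod (\prod_(N <= k < n) (1 - a k)).
Proof.
have [nN|/ltnW Nn] := leqP n N; first by rewrite !big_geq // subr0 cmod1.
elim: n Nn => [|n IH]; first by rewrite leqn0 => /eqP ->; rewrite !big_geq // subr0 cmod1.
rewrite leq_eqVlt => /orP[/eqP ->|]; first by rewrite !big_geq // subr0 cmod1.
rewrite ltnS => Nn; rewrite !big_nat_recr //= cmodM; have := IH Nn.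
set S := \sum_(_ <= _ < _) _; set P := cmod (\prod_(_ <= _ < _) _).
have S0 : 0 <= S by rewrite sumr_ge0 // => k _; exact: cmod_ge0.
have P0 : 0 <= P := cmod_ge0 _.
have := cmodB_ge 1 (a n); rewrite cmod1; have := cmod_ge0 (a n).
move: (cmod (a n)) (cmod (1 - a n)) (cmod_ge0 (1 - a n)) => x y y0 x0 xy SP.
have [h|h] := leP 1 (S + x); first by have := mulr_ge0 P0 y0; lra.
have : (1 - S) * (1 - x) <= P * y by rewrite ler_pM //; lra.
have := mulr_ge0 S0 x0; lra.
Qed.

Lemma prod1D_le_expR (R : realType) (t : nat -> R) (N n : nat) :
  (forall k, 0 <= t k) ->
  \prod_(N <= k < n) (1 + t k) <= expR (\sum_(N <= k < n) t k).
Proof.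
move=> t0; rewrite expR_sum; apply: ler_prod => k _.
by rewrite expR_ge1Dx andbT addr_ge0.
Qed.

Lemma infprod_cvg_prod (R : realType) (a : nat -> R[i]) (p : R[i]) :
  infprod_cvg_to a p -> (\prod_(0 <= k < n) a k) @[n --> \oo] --> p.
Proof.
move=> [N [q [_ aq ->]]].
have h : (\prod_(0 <= k < N) a k) * (\prod_(N <= k < n) a k) @[n --> \oo]
    --> (\prod_(0 <= k < N) a k) * q.
  by apply: cvgM; [exact: cvg_cst|exact: aq].
move: h; apply: cvg_trans; apply: near_eq_cvg; near=> n.
by rewrite -big_cat_nat //=; near: n; exists N.
Unshelve. all: by end_near.
Qed.

(** The increments of the partial products are dominated by those of the products of 1 + |a_k|,
    which are bounded. Removing factors until the remaining sum is at most 1/2 keeps the limit at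
    modulus at least 1/2, hence nonzero. *)
Lemma infprod_summable (R : realType) (a : nat -> R[i]) (B : R) :
  (forall n, \sum_(0 <= k < n) cmod (a k) <= B) ->
  exists p, infprod_cvg_to (fun k => 1 - a k) p.
Proof.
move=> aB.
have [||N hN] := @summable_tail R (fun k => cmod (a k)) B 2^-1 _ aB.
- by move=> k; exact: cmod_ge0.
- by [].
pose u n := \prod_(N <= k < N + n) (1 - a k).
pose v n := \prod_(N <= k < N + n) (1 + cmod (a k)).
have [||q hq] := @complex_cvg_majorant R u v (expR 2^-1).
- move=> n; rewrite /u /v addnS !big_nat_recr ?leq_addr //=.
  rewrite mulrBr mulr1 addrC addKr cmodN cmodM mulrDr mulr1 addrC addKr.
  rewrite ler_wpM2r ?cmod_ge0 // cmod_prod; apply: ler_prod => k _.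
  by rewrite cmod_ge0 /=; have := cmodB 1 (a k); rewrite cmod1.
- move=> n; apply: le_trans (prod1D_le_expR _ _ _) _; last by rewrite ler_expR.
  by move=> k; exact: cmod_ge0.
have hu : (\prod_(N <= k < n) (1 - a k)) @[n --> \oo] --> q.
  rewrite -(cvg_shiftn N); apply: cvg_trans hq; apply: near_eq_cvg.
  by apply: nearW => n; rewrite /u addnC.
exists ((\prod_(0 <= k < N) (1 - a k)) * q), N, q; split=> //.
rewrite -cmod_gt0 (@lt_le_trans _ _ 2^-1) //.
apply: (cmod_cvg_ge _ hu); apply: nearW => n.
apply: le_trans (cmod_prod1B_ge _ _ _); have := hN n; lra.
Qed.

(** * Polynomial partial products and the entire function they define *)

Definition circle_factor (R : rcfType) (r : R) (n : nat) : {poly R[i]} :=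
  1 - ((r^-1)%:C ^+ n) *: 'X^n.

Definition partial_product (R : rcfType) (r : nat -> R) (n : nat -> nat) m :
  {poly R[i]} := \prod_(0 <= k < m) circle_factor (r k) (n k).

Lemma horner_factor (R : rcfType) (r : R) n z :
  (circle_factor r n).[z] = 1 - (z / r%:C) ^+ n.
Proof.
by rewrite /circle_factor hornerD hornerN hornerZ hornerXn hornerC mulrC -exprMn fmorphV.
Qed.

Lemma horner_partial_product (R : rcfType) (r : nat -> R) n m z :
  (partial_product r n m).[z] = \prod_(0 <= k < m) (1 - (z / (r k)%:C) ^+ n k).
Proof. by rewrite horner_prod; apply: eq_bigr => k _; exact: horner_factor. Qed.

Lemma cmod_term (R : rcfType) (r : R) n z : 0 < r ->
  cmod ((z / r%:C) ^+ n) = (cmod z / r) ^+ n.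
Proof. by move=> r0; rewrite cmodX cmodM cmodV cmodC gtr0_norm. Qed.

(** The derivatives are returned together with their approximation by partial products, because the
    bounds at the zeros are proved for the latter. *)
Lemma product_entire (R : realType) (r : nat -> R) (n : nat -> nat) :
  (forall k, 0 < r k) ->
  (forall A, 0 < A -> exists B, forall m, \sum_(0 <= k < m) (A / r k) ^+ n k <= B) ->
  exists f f1 f2 : R[i] -> R[i],
  [/\ (forall z, infprod_cvg_to (fun k => 1 - (z / (r k)%:C) ^+ n k) (f z)),
      (forall z : R[i], is_derive z 1 f (f1 z)), (forall z : R[i], is_derive z 1 f1
        (f2 z)),
      (forall z, (partial_product r n m)^`().[z] @[m --> \oo] --> f1 z) &
      (forall z, (partial_product r n m)^`(2).[z] @[m --> \oo] --> f2 z)].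
Proof.
move=> r0 sumB; pose q m := \prod_(0 <= k < m) (1 + ((r k)^-1 ^+ n k) *: 'X^(n k) :
  {poly R}).
have maj1 : majorized (1 : {poly R[i]}) (1 : {poly R}).
  by move=> i; rewrite !coef1 cmodnat.
have majX k : majorized (((r k)^-1)%:C ^+ n k *: 'X^(n k)) ((r k)^-1 ^+ n k *: 'X^(n k)).
  move=> i; rewrite !coefZ !coefXn cmodM cmodX cmodC cmodnat ger0_norm //.
  by rewrite invr_ge0 ltW.
have maj m : majorized (partial_product r n m) (q m).
  rewrite /partial_product /q; elim: m => [|m IH]; first by rewrite !big_geq.
  rewrite !big_nat_recr //=; apply: majorizedM IH _; apply: majorizedD maj1 _.
  exact/majorizedN/majX.
have majS m : majorized (partial_product r n m.+1 - partial_product r n m) (q m.+1 - q m).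
  rewrite /partial_product /q !big_nat_recr //= mulrBr mulr1 addrC addKr.
  rewrite mulrDr mulr1 [X in majorized _ X]addrC addKr.
  by apply: majorizedN; apply: majorizedM; [exact: maj|exact: majX].
have qB A : 0 < A -> exists B, forall m, (q m).[A] <= B.
  move=> A0; have [B hB] := sumB _ A0; exists (expR B) => m.
  rewrite /q horner_prod;
    apply: le_trans (_ : _ <= \prod_(0 <= k < m) (1 + (A / r k) ^+ n k)) _.
    apply: ler_prod => k _;
      rewrite hornerD hornerC hornerZ hornerXn -exprMn mulrC lexx andbT.
    by rewrite addr_ge0 // exprn_ge0 // divr_ge0 ?ltW.
  apply: le_trans (prod1D_le_expR _ _ _) _; last by rewrite ler_expR.
  by move=> k; rewrite exprn_ge0 // divr_ge0 ?ltW.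
pose F := limit_derivn (maj 0%N) majS qB.
exists (F 0%N), (F 1%N), (F 2%N); split=> z.
- have A0 : 0 < cmod z + 1 by rewrite ltr_wpDl ?cmod_ge0.
  have [B hB] := sumB _ A0.
  have [|p hp] := @infprod_summable _ (fun k => (z / (r k)%:C) ^+ n k) B.
    move=> m; apply: le_trans (hB m); apply: ler_sum => k _.
    rewrite cmod_term // lerXn2r // ?nnegrE ?divr_ge0 ?cmod_ge0 //
      ?(ltW A0) ?(ltW (r0 k)) //.
    by rewrite ler_wpM2r ?invr_ge0 ?(ltW (r0 k)) // lerDl.
  (* [F 0] is only known as a pointwise limit of partial products; uniqueness of limits identifies
     it with a limit in the stronger sense of [infprod_cvg_to]. *)
  suff -> : F 0%N z = p by [].
  have := infprod_cvg_prod hp; have := @limit_derivnP _ _ _ (maj 0%N) majS qB 0 z.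
  under eq_fun do rewrite derivn0 horner_partial_product.
  by move=> h1 h2; apply: (cvg_unique _ h1 h2); exact: complex_hausdorff.
- exact: is_derive_limit.
- exact: is_derive_limit.
- by under eq_fun do rewrite -derivn1; exact: limit_derivnP.
- exact: limit_derivnP.
Qed.

(** * Products over rapidly growing circles *)

Section Lacunary.
Variables (R : realType) (r : nat -> R) (n : nat -> nat) (K : nat).
Hypothesis r0 : forall k, 0 < r k.
Hypothesis rinc : forall k, r k < r k.+1.
Hypothesis n0 : forall k, (0 < n k)%N.
Hypothesis ratio : forall k, (K <= k)%N -> 64 * r k <= r k.+1.

Lemma radius_mono j k : (j <= k)%N -> r j <= r k.
Proof.
suff h : {homo r : a b / (a <= b)%N >-> a <= b} by exact: h.
by apply: homo_leq => // [x y z|i]; [exact: le_trans|exact/ltW].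
Qed.

Lemma radius_lt j k : (j < k)%N -> r j < r k.
Proof. by move=> jk; apply: lt_le_trans (rinc j) _; exact: radius_mono. Qed.

(** The ratio gives 1/r_j <= 2 (1/r_j - 1/r_(j+1)), and the right side telescopes. *)
Lemma sum_inv_radius k m : (K <= k)%N -> \sum_(k <= j < m) (r j)^-1 <= 2 / r k.
Proof.
move=> Kk; have [mk|/ltnW km] := leqP m k.
  by rewrite big_geq // divr_ge0 ?ltW.
apply: le_trans (_ : _ <= \sum_(k <= j < m) 2 * ((r j)^-1 - (r j.+1)^-1)) _.
  apply: ler_sum_nat => j /andP[kj _].
  have : (r j.+1)^-1 <= (64 * r j)^-1.
    by rewrite lef_pV2 ?posrE ?mulr_gt0 ?r0 // ratio // (leq_trans Kk).
  rewrite invfM; have : 0 < (r j)^-1 by rewrite invr_gt0.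
  by move: (_^-1) (_^-1) => a b; lra.
rewrite -mulr_sumr ler_wpM2l //.
under eq_bigr do rewrite -opprB; rewrite sumrN telescope_sumr // opprB.
by rewrite lerBlDr lerDl invr_ge0 ltW.
Qed.

(** The bases are at most 1, so each exponent [n j] can be lowered to 1 and the bound does not
    depend on the exponents. *)
Lemma sum_terms_tail k m A : (K <= k)%N -> 0 <= A <= r k ->
  \sum_(k <= j < m) (A / r j) ^+ n j <= 2 * (A / r k).
Proof.
move=> Kk /andP[A0 Ar].
apply: le_trans (_ : _ <= \sum_(k <= j < m) A / r j) _.
  apply: ler_sum_nat => j /andP[kj _]; rewrite -[leRHS]expr1.
  apply: ler_wiXn2l => //; first by rewrite divr_ge0 // ltW.
  by rewrite ler_pdivrMr // mul1r (le_trans Ar) // radius_mono.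
by rewrite -mulr_sumr mulrCA ler_wpM2l // sum_inv_radius.
Qed.

Lemma cmod_factor_ge j (z : R[i]) : 2 * r j <= cmod z ->
  1 <= cmod z / r j - 1 /\ cmod z / r j - 1 <= cmod (1 - (z / (r j)%:C) ^+ n j).
Proof.
move=> rz; have h : 2 <= cmod z / r j by rewrite ler_pdivlMr.
split; first lra.
rewrite cmodBC; apply: le_trans (cmodB_ge _ _); rewrite cmod1 cmod_term // lerD2r.
by rewrite -[leLHS]expr1 ler_eXn2l //; lra.
Qed.

(** Here |z| / r_(k+1) <= 8/64, so the tail sum is at most 1/4. *)
Lemma cmod_tail_ge k m (z : R[i]) : (K <= k)%N -> cmod z <= 8 * r k ->
  2^-1 <= cmod (\prod_(k.+1 <= j < m) (1 - (z / (r j)%:C) ^+ n j)).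
Proof.
move=> Kk zr; apply: le_trans (cmod_prod1B_ge _ _ _).
have rk := ratio Kk.
have : \sum_(k.+1 <= j < m) cmod ((z / (r j)%:C) ^+ n j) <= 2 * (cmod z / r k.+1).
  under eq_bigr do rewrite cmod_term //.
  apply: sum_terms_tail; first exact: leqW.
  by rewrite cmod_ge0 /=; have := r0 k; lra.
have : cmod z / r k.+1 <= 8^-1.
  by rewrite ler_pdivrMr //; lra.
lra.
Qed.

(** Inner factors satisfy 1 + y^p <= (1 + y)^p, and each radius is replaced by the smallest one; the
    outer factors contribute at most the exponential of a sum bounded by 2. *)
Lemma prod_terms_le k m x : (K <= k)%N -> 0 <= x <= r k.+1 -> (k < m)%N ->
  \prod_(0 <= j < m) (1 + (x / r j) ^+ n j) <=
  (1 + x / r 0%N) ^+ (\sum_(0 <= j < k.+1) n j) * expR 2.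
Proof.
move=> Kk /andP[x0 xr] km.
have y0 j : 0 <= x / r j by rewrite divr_ge0 // ltW.
rewrite (@big_cat_nat _ _ _ k.+1) //= ler_pM //.
- by apply: prodr_ge0 => j _; rewrite addr_ge0 // exprn_ge0.
- by apply: prodr_ge0 => j _; rewrite addr_ge0 // exprn_ge0.
- rewrite -prodrXr; apply: ler_prod => j _; apply/andP; split.
    by rewrite addr_ge0 // exprn_ge0.
  have yy : x / r j <= x / r 0%N by rewrite ler_wpM2l // lef_pV2 ?posrE // radius_mono.
  apply: le_trans (_ : _ <= (1 + x / r j) ^+ n j) _; last first.
    by rewrite lerXn2r ?nnegrE ?addr_ge0 // lerD2l.
  move: (y0 j) (n0 j); move: (x / r j) (n j) => y [//|p] yy0 _.
  rewrite !exprS; have h : 1 <= (1 + y) ^+ p by rewrite exprn_ege1 // lerDl.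
  have h' : y ^+ p <= (1 + y) ^+ p by rewrite lerXn2r ?nnegrE ?addr_ge0 // lerDr.
  by rewrite mulrDl mul1r lerD // ler_wpM2l.
- apply: le_trans (prod1D_le_expR _ _ _) _; first by move=> j; rewrite exprn_ge0.
  rewrite ler_expR; apply: le_trans (sum_terms_tail _ _ _) _; first exact: leqW.
    by rewrite x0.
  by rewrite -[leRHS]mulr1 ler_wpM2l // ler_pdivrMr // mul1r.
Qed.

(** Where (z/r_k)^(n_k) is real and negative, the k-th factor attains its largest modulus on the
    circle; the outer factors cost at most 1/2. *)
Lemma cmod_product_ge k m x (z : R[i]) : (K <= k)%N -> (k < m)%N ->
  (forall j, (j < k)%N -> 2 * r j <= x) -> 0 <= x <= 8 * r k ->
  cmod z = x -> (z / (r k)%:C) ^+ n k = - ((x / r k) ^+ n k)%:C ->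
  2^-1 * (1 + (x / r k) ^+ n k) * \prod_(0 <= j < k) (x / r j - 1) <=
  cmod (\prod_(0 <= j < m) (1 - (z / (r j)%:C) ^+ n j)).
Proof.
move=> Kk km hx /andP[x0 xr] zx zk.
rewrite [X in _ <= cmod X](@big_cat_nat _ _ _ k.+1) //= big_nat_recr //=.
rewrite cmodM [X in _ <= X * _]cmodM [leRHS]mulrC -mulrA.
have p0 : 0 <= (x / r k) ^+ n k by rewrite exprn_ge0 // divr_ge0 // ltW.
have hk j : (0 <= j < k)%N -> 0 <= x / r j - 1 <= cmod (1 - (z / (r j)%:C) ^+ n j).
  move=> /andP[_ jk]; have := hx _ jk; rewrite -zx => h; have [h1 h2] := cmod_factor_ge h.
  by rewrite h2 andbT; lra.
have q0 : 0 <= \prod_(0 <= j < k) (x / r j - 1).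
  by rewrite big_nat; apply: prodr_ge0 => j /hk /andP[].
rewrite ler_pM ?cmod_tail_ge ?zx //; first by rewrite mulr_ge0 // addr_ge0.
rewrite mulrC ler_pM ?addr_ge0 //.
  by rewrite cmod_prod big_nat [leRHS]big_nat; exact: ler_prod.
rewrite zk opprK -[1 + _%:C]/((1 : R)%:C + _) -rmorphD cmodC ger0_norm ?addr_ge0 //.
Qed.

Lemma sum_terms_bounded : r k @[k --> \oo] --> +oo ->
  forall A, 0 < A -> exists B, forall m, \sum_(0 <= k < m) (A / r k) ^+ n k <= B.
Proof.
move=> /cvgryPge rlim A A0.
have [k [Kk Ak]] : exists k, (K <= k)%N /\ A <= r k.
  by apply: (@filter_ex _ \oo); apply: filterI; [exists K|exact: rlim].
exists (\sum_(0 <= j < k) (A / r j) ^+ n j + 2 * (A / r k)) => m.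
have t0 j : 0 <= (A / r j) ^+ n j by rewrite exprn_ge0 // divr_ge0 // ltW.
have [km|/ltnW mk] := leqP k m.
  by rewrite (@big_cat_nat _ _ _ k) //= lerD2l sum_terms_tail // Ak ltW.
rewrite [X in _ <= X + _](@big_cat_nat _ _ _ m) //= -addrA lerDl addr_ge0 ?sumr_ge0 //.
by rewrite mulr_ge0 // divr_ge0 // ltW.
Qed.

End Lacunary.

(** * Derivatives at the zeros *)

Lemma complexRV (R : rcfType) (x : R) : (x^-1)%:C = x%:C^-1.
Proof. exact: fmorphV. Qed.

(** Multiplication by [z] restores the power [n], so that at a zero, where (z/r)^n = 1, the value is
    simply -n. *)
Lemma horner_deriv_factor (R : rcfType) (r : R) (n : nat) (z : R[i]) :
  z * (circle_factor r n)^`().[z] = - (n%:R * (z / r%:C) ^+ n).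
Proof.
rewrite /circle_factor derivB -(polyC1 R[i]) derivC sub0r derivZ derivXn hornerN
  hornerZ hornerMn hornerXn.
case: n => [|n]; first by rewrite mulr0n mul0r !mulr0 oppr0 mulr0.
by rewrite /= exprMn complexRV -[z ^+ n *+ _]mulr_natl !exprS; ring.
Qed.

Lemma horner_deriv2_factor (R : rcfType) (r : R) (n : nat) (z : R[i]) : (0 < n)%N ->
  z ^+ 2 * (circle_factor r n)^`(2).[z] = - (n%:R * (n%:R - 1) * (z / r%:C) ^+ n).
Proof.
rewrite !derivnS derivn0 /circle_factor derivB -(polyC1 R[i]) derivC sub0r derivZ derivXn.
rewrite derivN derivZ derivMn derivXn hornerN hornerZ !hornerMn hornerXn.
case: n => // [[|n]] _;
  first by rewrite /= mulr0n mul0rn mulr0 oppr0 mulr0 subrr mulr0 mul0r oppr0.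
rewrite /= exprMn complexRV -[z ^+ n *+ _]mulr_natl -[_ * z ^+ n *+ _]mulr_natl !exprS.
have -> : (n.+2%:R : R[i]) = n.+1%:R + 1 by rewrite -addn1 natrD.
by ring.
Qed.

(** Logarithmic derivative: z P'/P is the sum of the z F_j'/F_j. *)
Lemma cmod_deriv_prod (R : rcfType) (I : eqType) (s : seq I) (F : I -> {poly R[i]}) z :
  (forall j, j \in s -> (F j).[z] != 0) ->
  cmod (z * (\prod_(j <- s) F j)^`().[z]) <=
  cmod (\prod_(j <- s) F j).[z] * \sum_(j <- s) cmod (z * (F j)^`().[z]) / cmod (F j).[z].
Proof.
elim: s => [|i s IH] F0.
  by rewrite !big_nil -(polyC1 R[i]) derivC horner0 !mulr0 cmod0.
rewrite !big_cons derivM hornerD !hornerM mulrDr mulrDr.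
apply: le_trans (cmodD _ _) _; apply: lerD.
  rewrite [z * (_ * _)]mulrA [cmod (z * _ * _)]cmodM [cmod ((F i).[z] * _)]cmodM.
  have a0 : cmod (F i).[z] != 0 by rewrite cmod_eq0 F0 ?mem_head.
  have E (x y a : R) : a != 0 -> x * y <= a * y * (x / a).
    by move=> a0'; rewrite [leRHS](_ : _ = x * y) //; field.
  exact: E.
rewrite [z * (_ * _)]mulrCA [cmod ((F i).[z] * (z * _))]cmodM [cmod ((F i).[z] *
  _)]cmodM -mulrA.
by rewrite ler_wpM2l ?cmod_ge0 // IH // => j js; rewrite F0 // in_cons js orbT.
Qed.

(** Since n <= 2^n, the left side is at most (2y)^n. The bound is free of [n], so large exponents on
    outer circles do no harm. *)
Lemma exp_term_le (R : realFieldType) (y : R) (n : nat) :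
  (0 < n)%N -> 0 <= y -> 2 * y <= 1 -> n%:R * y ^+ n <= 2 * y.
Proof.
move=> n0 y0 y1; apply: le_trans (_ : _ <= (2 * y) ^+ n) _.
  by rewrite exprMn ler_wpM2r ?exprn_ge0 // -natrX ler_nat ltnW // ltn_expl.
by rewrite -[leRHS]expr1 ler_wiXn2l // mulr_ge0.
Qed.

Lemma prod_ge1 (R : realFieldType) (I : Type) (s : seq I) (P : pred I) (F : I -> R) :
  (forall i, P i -> 1 <= F i) -> 1 <= \prod_(i <- s | P i) F i.
Proof.
by move=> F1; apply: (big_ind (fun x => 1 <= x)) => // x y; exact: mulr_ege1.
Qed.

(** With u = (z/r_j)^(n_j) one has z F_j'/F_j = - n_j u/(1 - u). Here the j-th circle lies inside
    that of [z]; [cmod_div1B_small] is for the circles outside. *)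
Lemma cmod_div1B_large (R : rcfType) (u : R[i]) :
  2 <= cmod u -> cmod u / cmod (1 - u) <= 2.
Proof.
move=> u2; have := cmodB_ge u 1; rewrite cmod1 cmodBC => h.
by rewrite ler_pdivrMr; lra.
Qed.

Lemma cmod_div1B_small (R : rcfType) (u : R[i]) :
  2 * cmod u <= 1 -> cmod u / cmod (1 - u) <= 2 * cmod u.
Proof.
move=> u2; have := cmodB_ge 1 u; rewrite cmod1 => h; have := cmod_ge0 u => u0.
rewrite ler_pdivrMr; last by lra.
nra.
Qed.

Section Zeros.
Variables (R : realType) (r : nat -> R) (n : nat -> nat) (K : nat).
Hypothesis r0 : forall k, 0 < r k.
Hypothesis rinc : forall k, r k < r k.+1.
Hypothesis n0 : forall k, (0 < n k)%N.
Hypothesis ratio : forall k, (K <= k)%N -> 64 * r k <= r k.+1.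

Let F (j : nat) : {poly R[i]} := circle_factor (r j) (n j).

Lemma partial_product_split k m : (k < m)%N -> partial_product r n m =
  F k * ((\prod_(0 <= j < k) F j) * (\prod_(k.+1 <= j < m) F j)).
Proof.
move=> km; rewrite /partial_product (@big_cat_nat _ _ _ k); [|exact: leq0n|exact: ltnW].
rewrite (big_ltn km); exact: mulrCA.
Qed.

Lemma deriv_product_at_zero k m (z : R[i]) : (k < m)%N ->
  (z / (r k)%:C) ^+ n k = 1 ->
  z * (partial_product r n m)^`().[z] =
  - ((n k)%:R * ((\prod_(0 <= j < k) F j).[z] * (\prod_(k.+1 <= j < m) F j).[z])).
Proof.
move=> km zk; rewrite (partial_product_split km) /F.
move: (\prod_(0 <= j < k) _) (\prod_(k.+1 <= j < m) _) => A B.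
rewrite derivM hornerD [(circle_factor _ _ * _).[z]]hornerM horner_factor zk.
rewrite subrr mul0r addr0 hornerM [z * _]mulrA horner_deriv_factor zk mulr1 hornerM.
exact: mulNr.
Qed.

(** This covers every circle, also those before index [K]: the other factors up to [L] are finitely
    many and nonzero at [z], the later ones have product at least 1/2. As [c] does not depend on
    [m], the limit f'(z) is nonzero. *)
Lemma deriv_product_at_zero_gt0 k (z : R[i]) : z != 0 -> cmod z = r k ->
  (z / (r k)%:C) ^+ n k = 1 ->
  exists2 c : R, 0 < c &
    \forall m \near \oo, c <= cmod (partial_product r n m)^`().[z].
Proof.
move=> z0 zr zk; set L := maxn k K.
have F0 j : j != k -> 0 < cmod (F j).[z].
  move=> jk; rewrite cmod_gt0 horner_factor subr_eq0 eq_sym;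
    apply: contra jk => /eqP /(congr1 (@cmod R)).
  rewrite cmod_term // cmod1 zr => /eqP; rewrite pexpr_eq1 ?divr_ge0 ?ltW //.
  rewrite -subr_eq0 -[X in _ - X](divff (lt0r_neq0 (r0 j))) -mulrBl mulf_eq0 invr_eq0.
  rewrite (gt_eqF (r0 j)) orbF subr_eq0; case: (ltngtP k j) => // h /eqP e.
    by have := radius_lt rinc h; rewrite e ltxx.
  by have := radius_lt rinc h; rewrite e ltxx.
set c := (cmod z)^-1 * ((n k)%:R * (cmod (\prod_(0 <= j < k) F j).[z] *
   (cmod (\prod_(k.+1 <= j < L.+1) F j).[z] * 2^-1))).
exists c.
  rewrite /c !mulr_gt0 // ?invr_gt0 ?zr ?r0 ?ltr0n ?n0 //.
    rewrite horner_prod cmod_prod big_nat; apply: prodr_gt0 => j /andP[_ jk].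
    by apply: F0; rewrite ltn_eqF.
  rewrite horner_prod cmod_prod big_nat; apply: prodr_gt0 => j /andP[jk _].
  by apply: F0; rewrite gtn_eqF.
exists L.+1 => // m /= Lm; have km : (k < m)%N by rewrite (leq_trans _ Lm) //
  ltnS leq_maxl.
have := congr1 (@cmod R) (deriv_product_at_zero km zk).
rewrite cmodN cmodM => /(congr1 (fun x => (cmod z)^-1 * x));
  rewrite mulKf ?cmod_eq0 // => ->.
rewrite !cmodM cmodnat ler_wpM2l ?invr_ge0 ?cmod_ge0 // ler_wpM2l //
  ler_wpM2l ?cmod_ge0 //.
rewrite [X in _ <= cmod X.[z]](@big_cat_nat _ _ _ L.+1);
  [|by rewrite ltnS leq_maxl|exact: Lm].
rewrite hornerM cmodM.
rewrite ler_wpM2l ?cmod_ge0 // horner_prod.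
under eq_bigr do rewrite horner_factor.
apply: (cmod_tail_ge r0 rinc n0 ratio); first exact: leq_maxr.
rewrite zr; have := radius_mono rinc (leq_maxl k K); have := r0 L; rewrite -/L; lra.
Qed.

(** The hypothesis on [C] bounds |zH'/H| by C n_k: each inner circle contributes at most 2 n_j, all
    outer circles together at most 1. *)
Lemma ratio_at_zero k m (z : R[i]) (C : R) : (K <= k)%N -> (k < m)%N ->
  (forall j, (j < k)%N -> 2 * r j <= r k) ->
  2 * (\sum_(0 <= j < k) n j)%:R + 1 <= C * (n k)%:R ->
  cmod z = r k -> (z / (r k)%:C) ^+ n k = 1 ->
  cmod ((partial_product r n m)^`(2).[z] / (partial_product r n m)^`().[z] ^+ 2)
    <= 2 * (1 + 2 * C).
Proof.
move=> Kk km hr hC zr zk.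
have z0 : z != 0 by rewrite -cmod_gt0 zr.
have nk0 : 0 < (n k)%:R :> R by rewrite ltr0n.
set A := \prod_(0 <= j < k) F j; set B := \prod_(k.+1 <= j < m) F j.
have FA j : j \in index_iota 0 k -> 1 <= cmod (F j).[z] /\
    cmod (z * (F j)^`().[z]) / cmod (F j).[z] <= 2 * (n j)%:R.
  rewrite mem_index_iota => /andP[_ jk].
  have h2 : 2 * r j <= cmod z by rewrite zr hr.
  have [h3 h4] := cmod_factor_ge r0 n0 h2.
  rewrite horner_deriv_factor horner_factor cmodN cmodM cmodnat.
  split; first exact: le_trans h4.
  rewrite -mulrA [2 * _]mulrC ler_wpM2l // cmod_div1B_large // cmod_term //.
  rewrite (@le_trans _ _ (cmod z / r j)) //; first by lra.
  by rewrite -[leLHS]expr1 ler_eXn2l //; lra.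
(* The constant 4 is a 2 from [exp_term_le] times a 2 from [cmod_div1B_small]. *)
have FB j : j \in index_iota k.+1 m -> 0 < cmod (F j).[z] /\
    cmod (z * (F j)^`().[z]) / cmod (F j).[z] <= 4 * (r k / r j).
  rewrite mem_index_iota => /andP[kj _].
  have rj : 64 * r k <= r j := le_trans (ratio Kk) (radius_mono rinc kj).
  have y0 : 0 <= r k / r j by rewrite divr_ge0 // ltW.
  have y1 : 64 * (r k / r j) <= 1 by rewrite mulrA ler_pdivrMr // mul1r.
  have u1 : 2 * cmod ((z / (r j)%:C) ^+ n j) <= 1.
    rewrite cmod_term // zr; apply: le_trans (_ : _ <= 2 * (r k / r j)) _; last by lra.
    by rewrite ler_wpM2l // -[leRHS]expr1 ler_wiXn2l //; lra.
  rewrite horner_deriv_factor horner_factor cmodN cmodM cmodnat; split.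
    have := cmodB_ge 1 ((z / (r j)%:C) ^+ n j); rewrite cmod1; lra.
  rewrite -mulrA; apply: le_trans (ler_wpM2l (ler0n _ _) (cmod_div1B_small u1)) _.
  rewrite cmod_term // zr mulrCA.
  have : (n j)%:R * (r k / r j) ^+ n j <= 2 * (r k / r j) by apply: exp_term_le =>
    //; lra.
  lra.
have A1 : 1 <= cmod A.[z].
  rewrite horner_prod cmod_prod big_seq; apply: prod_ge1 => j jk.
  by have [] := FA _ jk.
have B1 : 2^-1 <= cmod B.[z].
  rewrite horner_prod; under eq_bigr do rewrite horner_factor.
  apply: (cmod_tail_ge r0 rinc n0 ratio) => //; rewrite zr; have := r0 k; lra.
have hA : cmod (z * A^`().[z]) <= cmod A.[z] * (2 * (\sum_(0 <= j < k) n j)%:R).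
  apply: le_trans (cmod_deriv_prod _) _.
    by move=> j /FA[h _]; rewrite -cmod_gt0 (lt_le_trans ltr01).
  rewrite ler_wpM2l ?cmod_ge0 // natr_sum mulr_sumr big_seq [leRHS]big_seq.
  by apply: ler_sum => j /FA[].
(* The sum of logarithmic derivatives is at most 8 r_k / r_(k+1) <= 1/8. *)
have hB : cmod (z * B^`().[z]) <= cmod B.[z] * 1.
  apply: le_trans (cmod_deriv_prod _) _.
    by move=> j /FB[h _]; rewrite -cmod_gt0.
  rewrite ler_wpM2l ?cmod_ge0 //.
  apply: le_trans (_ : _ <= \sum_(k.+1 <= j < m) 4 * (r k / r j)) _.
    by rewrite big_seq [leRHS]big_seq; apply: ler_sum => j /FB[].
  under eq_bigr do rewrite mulrA; rewrite -mulr_sumr.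
  have rk := ratio Kk.
  apply: le_trans (_ : _ <= 4 * r k * (2 / r k.+1)) _.
    by rewrite ler_wpM2l ?mulr_ge0 ?(ltW (r0 _)) // (sum_inv_radius r0 ratio) // leqW.
  by rewrite mulrA ler_pdivrMr //; have := r0 k; lra.
set H := (A * B); have hH : cmod (z * H^`().[z]) <= cmod H.[z] * (C * (n k)%:R).
  rewrite /H derivM hornerD !hornerM mulrDr; apply: le_trans (cmodD _ _) _.
  rewrite [z * (A^`().[z] * _)]mulrA [z * (A.[z] * _)]mulrCA.
  rewrite [cmod (_ * _ * B.[z])]cmodM [cmod (A.[z] * (_ * _))]cmodM [cmod (A.[z] *
    _)]cmodM.
  apply: le_trans (lerD (ler_wpM2r (cmod_ge0 _) hA) (ler_wpM2l (cmod_ge0 _) hB)) _.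
  apply: le_trans (_ : _ <= cmod A.[z] * cmod B.[z] * (2 * (\sum_(0 <= j < k) n j)%:R
    + 1)) _.
    by rewrite le_eqVlt; apply/orP; left; apply/eqP; ring.
  by rewrite ler_wpM2l // mulr_ge0 ?cmod_ge0.
have H1 : 2^-1 <= cmod H.[z].
  by rewrite hornerM cmodM -[leLHS]mul1r ler_pM.
have e1 := deriv_product_at_zero km zk; rewrite -/A -/B -hornerM -/H in e1.
(* As [F k] vanishes at [z], the Leibniz rule leaves F_k'' H + 2 F_k' H'. *)
have e2 : z ^+ 2 * (partial_product r n m)^`(2).[z] =
    - ((n k)%:R * (((n k)%:R - 1) * H.[z] + 2 * (z * H^`().[z]))).
  rewrite (partial_product_split km) -/A -/B -/H !derivnS derivn0.
  rewrite derivM derivD !derivM !hornerD !hornerM.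
  have := horner_deriv2_factor (r k) z (n0 k); rewrite zk mulr1 !derivnS derivn0 => d2.
  have := horner_deriv_factor (r k) (n k) z; rewrite zk mulr1 => d1.
  have -> : (F k).[z] = 0 by rewrite horner_factor zk subrr.
  rewrite mul0r addr0 !mulrDr !mulrA d2.
  rewrite [z ^+ 2 * _](_ : _ = z * (z * (F k)^`().[z])); last by rewrite mulrA.
  by rewrite d1 !(hornerD, hornerM); ring.
move: H1 hH e1 e2; move: (H.[z]) (z * H^`().[z]) => h l h1 hl.
move: ((partial_product r n m)^`().[z]) ((partial_product r n m)^`(2).[z]) => p1 p2.
move=> /(congr1 (@cmod R)) e1 /(congr1 (@cmod R)) e2.
rewrite cmodM cmodV cmodX; move: e1 e2; rewrite !cmodN !cmodM cmodnat.
have a0 : 0 < cmod z by rewrite cmod_gt0.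
have n1 : cmod (((n k)%:R : R[i]) - 1) <= (n k)%:R.
  have -> : ((n k)%:R : R[i]) - 1 = (n k - 1)%:R by rewrite natrB.
  by rewrite cmodnat ler_nat leq_subr.
have : cmod (((n k)%:R - 1) * h + 2 * l) <= (n k)%:R * cmod h * (1 + 2 * C).
  apply: le_trans (cmodD _ _) _; rewrite !cmodM (cmodnat _ 2).
  apply: le_trans (lerD (ler_wpM2r (cmod_ge0 _) n1) (ler_wpM2l _ hl)) _ => //.
  by rewrite le_eqVlt; apply/orP; left; apply/eqP; ring.
have C0 : 0 <= C.
  have : 0 <= C * (n k)%:R by apply: le_trans hC; rewrite addr_ge0 // mulr_ge0.
  by rewrite pmulr_lge0.
(* Only real numbers remain: [a] = |z| cancels, the quotient is [w / (N * x ^+ 2)] with [x] =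
   |H(z)|, and [2 * x >= 1]. *)
move: (cmod (_ + _)) (cmod z) (cmod h) (cmod p1) (cmod p2) ((n k)%:R : R) a0 h1 nk0 C0.
move=> {hC hl} w a x q1 q2 N a0 x1 N0 C0 hw e1 e2.
have x0 : 0 < x by lra.
have -> : q2 = N * w / (a * a) by rewrite -e2 mulrC mulKf // mulf_neq0 // gt_eqF.
have -> : q1 = N * x / a by rewrite -e1 mulrC mulKf // gt_eqF.
rewrite (_ : _ / _ / _ = w / (N * x ^+ 2)); last first.
  by field; rewrite !gt_eqF.
rewrite ler_pdivrMr ?mulr_gt0 ?exprn_gt0 //; apply: le_trans hw _.
rewrite [leRHS](_ : _ = N * x * (1 + 2 * C) * (2 * x)); last by ring.
by rewrite ler_peMr //; [rewrite !mulr_ge0 ?(ltW N0) ?(ltW x0) //|]; lra.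
Qed.

End Zeros.

(** * Enumeration of the zeros *)

(** The roots are distinct because X^m - 1 is separable in characteristic 0. *)
Lemma unity_roots (R : realType) (m : nat) : (0 < m)%N ->
  exists s : seq R[i],
    [/\ size s = m, uniq s & 'X^m - 1 = \prod_(w <- s) ('X - w%:P)].
Proof.
move=> m0; have [s] := closed_field_poly_normal ('X^m - 1 : {poly R[i]}).
rewrite -(polyC1 R[i]) lead_coefXnsubC // scale1r polyC1 => sE; exists s; split => //.
  have := congr1 (fun p : {poly R[i]} => size p) sE.
  by rewrite /= -(polyC1 R[i]) size_XnsubC // size_prod_XsubC => -[].
by rewrite -separable_prod_XsubC -sE separable_Xn_sub_1 // pnatr_eq0 -lt0n.
Qed.

Section UnityRoots.
Variables (R : realType) (m : nat) (s : seq R[i]).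
Hypothesis m0 : (0 < m)%N.
Hypothesis sE : 'X^m - 1 = \prod_(w <- s) ('X - w%:P).

Lemma unity_rootP w : w \in s = (w ^+ m == 1).
Proof.
rewrite -root_prod_XsubC -sE rootE hornerD hornerN hornerXn -(polyC1 R[i]) hornerC.
by rewrite subr_eq0.
Qed.

(** Quotient of the values of X^m - 1 at [u] and at 0, since 1 - u/w = (u - w)/(0 - w). *)
Lemma prod_unity_roots u : \prod_(w <- s) (1 - u / w) = 1 - u ^+ m.
Proof.
have hE v : \prod_(w <- s) (v - w) = v ^+ m - 1.
  have := congr1 (fun p : {poly R[i]} => p.[v]) sE.
  rewrite /= hornerD hornerN hornerXn -(polyC1 R[i]) hornerC horner_prod => ->.
  by apply: eq_bigr => w _; rewrite hornerXsubC.
have w0 w : w \in s -> w != 0.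
  rewrite unity_rootP; apply: contraL => /eqP ->.
  by rewrite expr0n gtn_eqF // eq_sym oner_eq0.
transitivity (\prod_(w <- s) ((u - w) / (0 - w))).
  apply: eq_big_seq => w /w0 h; by field; rewrite ?oppr_eq0 h.
rewrite big_split /= prodfV !hE expr0n gtn_eqF // sub0r invrN invr1; ring.
Qed.

End UnityRoots.

Section Enumeration.
Variables (R : realType) (r : nat -> R) (n : nat -> nat).
Hypothesis r0 : forall k, 0 < r k.
Hypothesis rinc : forall k, r k < r k.+1.
Hypothesis n0 : forall k, (0 < n k)%N.

(** The zeros are numbered circle by circle; this is the index of the first zero on the k-th circle,
    and [block m] below is the circle carrying the m-th zero. *)
Definition block_start k := (\sum_(0 <= i < k) n i)%N.
Local Notation S := block_start.

Lemma block_startS k : S k.+1 = (S k + n k)%N.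
Proof. by rewrite /S big_nat_recr. Qed.

Lemma block_start_ge k : (k <= S k)%N.
Proof.
elim: k => // k IH; rewrite block_startS -addn1; exact: leq_add.
Qed.

Lemma block_start_mono j k : (j <= k)%N -> (S j <= S k)%N.
Proof.
move=> /subnKC <-; elim: (k - j)%N => [|i IH]; first by rewrite addn0.
by rewrite addnS block_startS (leq_trans IH) // leq_addr.
Qed.

Lemma block_exists m : exists k, (m < S k.+1)%N.
Proof. by exists m; exact: block_start_ge. Qed.

Definition block m := ex_minn (block_exists m).

Lemma block_bounds m : (S (block m) <= m < S (block m).+1)%N.
Proof.
rewrite /block; case: ex_minnP => k mk kmin; rewrite mk andbT.
case: k mk kmin => [|k] mk kmin; first by rewrite /S big_geq.
by rewrite leqNgt; apply/negP => /kmin; rewrite ltnn.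
Qed.

Lemma blockP k m : (S k <= m < S k.+1)%N -> block m = k.
Proof.
move=> /andP[h1 h2]; have /andP[h3 h4] := block_bounds m.
case: (ltngtP (block m) k) => // h; have := block_start_mono h; lia.
Qed.

Definition roots_of_block k : seq R[i] := sval (cid (unity_roots R (n0 k))).

Definition zeros m : R[i] :=
  (r (block m))%:C * nth 0 (roots_of_block (block m)) (m - S (block m)).

Lemma zerosE k j : (j < n k)%N -> zeros (S k + j) = (r k)%:C * nth 0 (roots_of_block k) j.
Proof.
move=> jn; rewrite /zeros; have -> : block (S k + j) = k.
  by apply: blockP; rewrite leq_addr block_startS ltn_add2l.
by rewrite addKn.
Qed.

Lemma roots_of_block_root k j : (j < n k)%N -> nth 0 (roots_of_block k) j ^+ n k = 1.
Proof.
move=> jn; rewrite /roots_of_block; case: cid => s /= [ss _ sE].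
by apply/eqP; rewrite -(unity_rootP sE) mem_nth // ss.
Qed.

Lemma index_in_block m : (m - S (block m) < n (block m))%N.
Proof. by have := block_bounds m; rewrite block_startS => /andP[h1 h2];
  rewrite ltn_subLR. Qed.

Lemma zeros_root m : (zeros m / (r (block m))%:C) ^+ n (block m) = 1.
Proof.
rewrite /zeros mulrAC divff ?mul1r; last by rewrite -cmod_gt0 cmodC normr_gt0 gt_eqF.
exact: roots_of_block_root (index_in_block m).
Qed.

Lemma cmod_zeros m : cmod (zeros m) = r (block m).
Proof.
have := congr1 (@cmod R) (zeros_root m).
rewrite cmod_term // cmod1 => /eqP; rewrite pexpr_eq1 //; last first.
  by rewrite divr_ge0 ?cmod_ge0 // ltW.
by rewrite -[1](divff (lt0r_neq0 (r0 (block m)))) => /eqP /divIf ->; rewrite // gt_eqF.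
Qed.

Lemma zeros_neq0 m : zeros m != 0.
Proof. by rewrite -cmod_gt0 cmod_zeros. Qed.

Lemma zeros_inj : injective zeros.
Proof.
move=> a b ab; have bl : block a = block b.
  have := congr1 (@cmod R) ab; rewrite !cmod_zeros.
  by case: (ltngtP (block a) (block b)) => // /(radius_lt rinc) h e; move: h;
    rewrite e ltxx.
have := ab; rewrite /zeros bl => /mulfI;
  rewrite -cmod_gt0 cmodC normr_gt0 gt_eqF // => /(_ isT).
have ha := index_in_block a; have hb := index_in_block b.
rewrite /roots_of_block; case: cid => s /= [ss us _] /eqP.
rewrite nth_uniq ?ss -?bl // => [/eqP e|]; last by rewrite bl.
have /andP[h1 _] := block_bounds a; have /andP[h2 _] := block_bounds b.
by move: h1 e; rewrite bl => h1 e; lia.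
Qed.

Lemma big_block (T : Type) (idx : T) (op : T -> T -> T) (G : nat -> T) k :
  \big[op/idx]_(S k <= m < S k.+1) G m = \big[op/idx]_(0 <= j < n k) G (S k + j)%N.
Proof.
rewrite -{1}[S k]add0n big_addn block_startS addKn.
by apply: eq_bigr => i _; rewrite addnC.
Qed.

(** The two kinds of partial products agree only at block ends; [infprod_zeros] bridges the rest by
    convergence. *)
Lemma zeros_prod z k : \prod_(0 <= m < S k) (1 - z / zeros m) =
  \prod_(0 <= i < k) (1 - (z / (r i)%:C) ^+ n i).
Proof.
elim: k => [|k IH]; first by rewrite /S !big_geq.
rewrite (@big_cat_nat _ _ _ (S k)) //=; last by rewrite block_startS leq_addr.
rewrite IH big_nat_recr //=.
congr (_ * _); rewrite big_block.
have -> : \prod_(0 <= i < n k) (1 - z / zeros (S k + i)%N) =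
    \prod_(w <- roots_of_block k) (1 - z / (r k)%:C / w).
  have ss : size (roots_of_block k) = n k by rewrite /roots_of_block; case: cid => s [].
  rewrite [RHS](big_nth 0) ss; apply: eq_big_nat => i /andP[_ ik].
  by rewrite zerosE // invfM mulrA.
by rewrite /roots_of_block; case: cid => s /= [_ _ sE]; exact: prod_unity_roots.
Qed.

Lemma zeros_sum (h : R -> R) k : \sum_(0 <= m < S k) h (cmod (zeros m)) =
  \sum_(0 <= i < k) (n i)%:R * h (r i).
Proof.
elim: k => [|k IH]; first by rewrite /S !big_geq.
rewrite (@big_cat_nat _ _ _ (S k)) //=; last by rewrite block_startS leq_addr.
rewrite IH big_nat_recr //=.
congr (_ + _); rewrite big_block.
under eq_big_nat => i /andP[_ ik].
  rewrite cmod_zeros (@blockP k); last by rewrite leq_addr block_startS ltn_add2l.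
  over.
by rewrite big_const_nat subn0 iter_addr addr0 mulr_natl.
Qed.

End Enumeration.

(** * Growth of the maximum modulus *)

Lemma limf_esup_pinfty (R : realType) (u : R -> R) (l : R) :
  (forall e, 0 < e -> exists X, forall x, X <= x -> u x <= l + e) ->
  (forall e X, 0 < e -> exists2 x, X <= x & l - e <= u x) ->
  limf_esup (fun x => (u x)%:E) (pinfty_nbhs R) = l%:E.
Proof.
move=> ub lb; apply/eqP; rewrite eq_le; apply/andP; split.
  apply/lee_addgt0Pr => e /ub[X hX]; apply: ge_ereal_inf.
  exists (ereal_sup [set (u x)%:E | x in [set x | X < x]]).
    exists [set x | X < x] => //; exists X; split => //; exact: num_real.
  by apply: ge_ereal_sup => _ [x /= /ltW /hX h <-]; rewrite -EFinD lee_fin.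
apply: le_ereal_inf_tmp => _ [V [X [_ hX]] <-].
apply/lee_subgt0Pr => e e0; have [x Xx hx] := lb e (X + 1) e0.
apply: le_trans (_ : _ <= (u x)%:E)%E _; first by rewrite -EFinB lee_fin.
by apply: ereal_sup_ubound; exists x => //; apply: hX; lra.
Qed.

Lemma limf_einf_pinfty (R : realType) (u : R -> R) (l : R) :
  (forall e, 0 < e -> exists X, forall x, X <= x -> l - e <= u x) ->
  (forall e X, 0 < e -> exists2 x, X <= x & u x <= l + e) ->
  limf_einf (fun x => (u x)%:E) (pinfty_nbhs R) = l%:E.
Proof.
move=> lb ub; rewrite /limf_einf.
have -> : limf_esup (\- (fun x => (u x)%:E))%E (pinfty_nbhs R) = (- l)%:E.
  apply: (@limf_esup_pinfty _ (fun x => - u x)) => [e /lb[X hX]|e X /ub].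
    by exists X => x /hX; lra.
  by move=> /(_ X)[x Xx hx]; exists x => //; lra.
by rewrite EFinN oppeK.
Qed.

Lemma affine_ln_le (R : realType) (a b e : R) : 0 < b -> 0 < e ->
  exists X, forall y, X <= y -> 0 < y -> a + b * ln y <= e * y.
Proof.
(* Then b ln (d y) <= b d y = e y / 2, and the bound on [y] makes a - b ln d at most e y / 2. *)
move=> b0 e0; pose d := e / (2 * b).
have d0 : 0 < d by rewrite divr_gt0 // mulr_gt0.
have bd : b * d = e / 2 by rewrite /d; field; rewrite gt_eqF.
exists (2 * (a - b * ln d) / e) => y; rewrite ler_pdivrMr // => hy y0.
have := ln_sublinear (mulr_gt0 d0 y0); rewrite lnM ?posrE // => h.
have : b * (ln d + ln y) <= b * (d * y) by rewrite ler_wpM2l // ltW.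
rewrite mulrA bd; lra.
Qed.

Lemma expR1_le4 (R : realType) : expR 1 <= 4 :> R.
Proof.
have h : 2^-1 <= expR (- 2^-1 : R) by apply: le_trans (expR_ge1Dx _); lra.
have h2 : expR 2^-1 <= 2 :> R.
  by rewrite -[X in expR X]opprK expRN -[leRHS]invrK lef_pV2 ?posrE ?expR_gt0 ?invr_gt0.
have -> : (1 : R) = 2^-1 + 2^-1 by lra.
rewrite expRD; have := ler_pM (expR_ge0 _) (expR_ge0 _) h2 h2; lra.
Qed.

Lemma max_modulus_le (R : realType) (f : R[i] -> R[i]) (x B : R) : 0 <= x ->
  (forall z, cmod z = x -> cmod (f z) <= B) -> max_modulus f x <= B.
Proof.
move=> x0 fB; apply: ge_sup; last by move=> _ [z /= zx <-]; exact: fB.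
have zx : cmod x%:C = x by rewrite cmodC ger0_norm.
by exists (cmod (f x%:C)); exists x%:C.
Qed.

Lemma max_modulus_ge (R : realType) (f : R[i] -> R[i]) (x B : R) z :
  (forall z, cmod z = x -> cmod (f z) <= B) -> cmod z = x ->
  cmod (f z) <= max_modulus f x.
Proof.
move=> fB zx; apply: ub_le_sup; last by exists z.
by exists B => _ [w /= wx <-]; exact: fB.
Qed.

Lemma exists_minus_root (R : realType) (m : nat) : (0 < m)%N ->
  exists2 w : R[i], cmod w = 1 & w ^+ m = -1.
Proof.
move=> m0; pose w : R[i] := m.-root (-1); have wm : w ^+ m = -1 by rewrite rootCK.
exists w => //; have := congr1 (@cmod R) wm; rewrite cmodN cmod1 cmodX => /eqP.
by rewrite pexpr_eq1 ?cmod_ge0 // => /eqP.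
Qed.

(** By doubling, the terms from [K] to [k] add up to at most 2 n_k, as in a geometric sum. *)
Lemma sum_n_le (n : nat -> nat) (K k : nat) :
  (forall i, (K <= i)%N -> (2 * n i <= n i.+1)%N) -> (K <= k)%N ->
  (\sum_(0 <= j < k.+1) n j <= \sum_(0 <= j < K) n j + 2 * n k)%N.
Proof.
move=> n_double; elim: k => [|k IH].
  by rewrite leqn0 => /eqP ->; rewrite big_nat_recr //= leq_add2l; lia.
rewrite leq_eqVlt => /orP[/eqP ->|]; first by rewrite big_nat_recr //= leq_add2l; lia.
rewrite ltnS => Kk; rewrite big_nat_recr //=.
by have := IH Kk; have := n_double _ Kk; lia.
Qed.

Lemma sum_n_le_mul (n : nat -> nat) (K k : nat) : (forall i, (0 < n i)%N) ->
  (forall i, (K <= i)%N -> (2 * n i <= n i.+1)%N) -> (K <= k)%N ->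
  (\sum_(0 <= j < k.+1) n j <= (\sum_(0 <= j < K) n j + 2) * n k)%N.
Proof.
move=> n0 n_double Kk; apply: leq_trans (sum_n_le n_double Kk) _;
  rewrite mulnDl leq_add2r.
by rewrite -[leqLHS]muln1 leq_mul2l n0 orbT.
Qed.

Section Growth.
Variables (R : realType) (rho : R) (r : nat -> R) (n : nat -> nat) (K : nat).
Variable f : R[i] -> R[i].
Hypothesis rho0 : 0 < rho.
Hypothesis r0 : forall k, 0 < r k.
Hypothesis rinc : forall k, r k < r k.+1.
Hypothesis rlim : r k @[k --> \oo] --> +oo.
Hypothesis n0 : forall k, (0 < n k)%N.
Hypothesis ratio : forall k, (K <= k)%N -> 64 * r k <= r k.+1.
Hypothesis expo : forall k, (K <= k)%N -> expR (r k) <= r k.+1.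
Hypothesis r1 : forall k, (K <= k)%N -> 1 <= r k.
Hypothesis n_ge : forall k, (K <= k)%N -> r k `^ rho <= 2 * (n k)%:R.
Hypothesis n_le : forall k, (K <= k)%N -> (n k)%:R <= 2 * r k `^ rho.
Hypothesis n_double : forall k, (K <= k)%N -> (2 * n k <= n k.+1)%N.
Hypothesis fP : forall z, infprod_cvg_to (fun k => 1 - (z / (r k)%:C) ^+ n k) (f z).

Lemma radius_unbounded X : exists2 k, (K <= k)%N & X <= r k.
Proof.
move: rlim => /cvgryPge /(_ X) h.
have [k [Kk Xk]] : exists k, (K <= k)%N /\ X <= r k.
  by apply: (@filter_ex _ \oo); apply: filterI; [exists K|exact: h].
by exists k.
Qed.

Lemma radius_bracket x : r K <= x -> exists2 k, (K <= k)%N & r k <= x < r k.+1.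
Proof.
move=> rx; have ex : exists k, x < r k.
  by have [k _ h] := radius_unbounded (x + 1); exists k; lra.
case: (ex_minnP ex) => -[|k] xk kmin.
  by have := radius_mono rinc (leq0n K); lra.
have kx : r k <= x by rewrite leNgt; apply/negP => /kmin; rewrite ltnn.
exists k; last by rewrite kx.
rewrite leqNgt; apply/negP => kK; have := radius_mono rinc kK; lra.
Qed.

Lemma cmod_f_le k x z : (K <= k)%N -> 0 <= x <= r k.+1 -> cmod z = x ->
  cmod (f z) <= (1 + x / r 0%N) ^+ (\sum_(0 <= j < k.+1) n j) * expR 2.
Proof.
move=> Kk xr zx; apply: (cmod_cvg_le _ (infprod_cvg_prod (fP z))).
exists k.+1 => // m /= km; apply: le_trans (prod_terms_le r0 rinc n0 ratio Kk xr km).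
rewrite cmod_prod; apply: ler_prod => j _; rewrite cmod_ge0 /=.
by apply: le_trans (cmodB _ _) _; rewrite cmod1 cmod_term // zx.
Qed.

Lemma cmod_f_bounded x : 0 <= x ->
  exists B, forall z, cmod z = x -> cmod (f z) <= B.
Proof.
move=> x0; have [k Kk xk] := radius_unbounded x.
eexists => z; apply: (cmod_f_le Kk); rewrite x0 /=; have := rinc k; lra.
Qed.

Lemma max_modulus_lower k x : (K <= k)%N ->
  (forall j, (j < k)%N -> 2 * r j <= x) -> 0 <= x <= 8 * r k ->
  2^-1 * (1 + (x / r k) ^+ n k) * \prod_(0 <= j < k) (x / r j - 1) <= max_modulus f x.
Proof.
move=> Kk hx /andP[x0 xr]; have [B fB] := cmod_f_bounded x0.
have [w w1 wn] := exists_minus_root R (n0 k).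
pose z := w * x%:C; have zx : cmod z = x by rewrite cmodM w1 mul1r cmodC ger0_norm.
have zk : (z / (r k)%:C) ^+ n k = - ((x / r k) ^+ n k)%:C.
  have e : (x / r k)%:C = x%:C / (r k)%:C by exact: fmorph_div.
  by rewrite /z -mulrA -e exprMn wn mulN1r -rmorphXn.
apply: le_trans (max_modulus_ge fB zx).
apply: (cmod_cvg_ge _ (infprod_cvg_prod (fP z))); exists k.+1 => // m /= km.
by apply: (cmod_product_ge r0 rinc n0 ratio Kk km hx _ zx zk); rewrite x0.
Qed.

Lemma prod_head_ge1 k x : (forall j, (j < k)%N -> 2 * r j <= x) ->
  1 <= \prod_(0 <= j < k) (x / r j - 1).
Proof.
move=> hx; rewrite big_nat; apply: prod_ge1 => j /andP[_ /hx h].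
have : 2 <= x / r j by rewrite ler_pdivlMr.
lra.
Qed.

(** This makes ln ln M nonnegative for large x, whence a lower order at least 0. With the least k
    such that x <= 2 r_k, all earlier radii are at most x/2. *)
Lemma max_modulus_ge_expR1 : exists X, forall x, X <= x -> expR 1 <= max_modulus f x.
Proof.
(* The term [2 * r K] forces the chosen index to be at least [K]; [9 * r 0] makes the factor of the
   smallest circle at least 8, and half of 8 is 4 >= e. *)
exists (2 * r K + 9 * r 0%N) => x Xx; have rK := r0 K; have r00 := r0 0%N.
have ex : exists k, x <= 2 * r k.
  by have [k _ h] := radius_unbounded x; exists k; have := r0 k; lra.
case: (ex_minnP ex) => -[|k] xk kmin.
  by have := radius_mono rinc (leq0n K); lra.
have hx j : (j < k.+1)%N -> 2 * r j <= x.
  move=> jk; rewrite leNgt; apply/negP => /ltW /kmin; lia.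
have Kk : (K <= k.+1)%N.
  rewrite leqNgt; apply/negP => kK; have := radius_mono rinc (ltnW kK); lra.
apply: le_trans (expR1_le4 R) _.
apply: le_trans (max_modulus_lower Kk hx _); last by have := r0 k.+1; lra.
have h1 : 9 <= x / r 0%N by rewrite ler_pdivlMr //; lra.
have h2 : 1 <= \prod_(1 <= j < k.+1) (x / r j - 1).
  rewrite big_nat; apply: prod_ge1 => j /andP[_ /hx h].
  have : 2 <= x / r j by rewrite ler_pdivlMr.
  lra.
have h3 : 0 <= (x / r k.+1) ^+ n k.+1 by rewrite exprn_ge0 // divr_ge0 ?ltW //
  (lt_le_trans rK); lra.
rewrite big_ltn //; move: h1 h2 h3.
move: (x / r 0%N) (\prod_(_ <= _ < _) _) (_ ^+ _) => a b c a9 b1 c0.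
have ab : 8 * 1 <= (a - 1) * b by rewrite ler_pM //; lra.
have : 2^-1 * 8 <= 2^-1 * (1 + c) * ((a - 1) * b) by rewrite ler_pM //; lra.
lra.
Qed.

Lemma max_modulus_at_8r k : (K <= k)%N -> expR (n k)%:R <= max_modulus f (8 * r k).
Proof.
move=> Kk; have rk := r0 k.
have hx j : (j < k)%N -> 2 * r j <= 8 * r k.
  by move=> /ltnW /(radius_mono rinc) h; have := r0 j; lra.
apply: le_trans (max_modulus_lower Kk hx _); last by rewrite lexx andbT; lra.
rewrite mulfK ?gt_eqF // -[(n k)%:R]mulr1 expRM_natl.
have h1 : expR 1 ^+ n k <= 4 ^+ n k :> R.
  by apply: lerXn2r; rewrite ?nnegrE ?expR_ge0 // expR1_le4.
(* As [n k >= 1], there is a factor 2 to spare, which offsets the 1/2 lost to the outer factors. *)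
have h2 : 4 ^+ n k * 2 <= 8 ^+ n k :> R.
  rewrite (_ : (8 : R) = 4 * 2) ?exprMn; last by lra.
  rewrite ler_wpM2l ?exprn_ge0 // -[leLHS]expr1 ler_eXn2l //; lra.
have := prod_head_ge1 hx; move: (\prod_(_ <= _ < _) _) => p p1.
apply: le_trans (_ : _ <= 2^-1 * (1 + 8 ^+ n k)) _; first by lra.
by rewrite ler_peMr // mulr_ge0 // addr_ge0 // exprn_ge0.
Qed.

(** A single bound, uniform in [k], serves twice: with r_k <= x for the order, and with x = exp(r_k)
    for the lower order. *)
Lemma lnln_max_modulus_le : exists C X, forall k x, (K <= k)%N ->
  r k <= x <= r k.+1 -> X <= x ->
  ln (ln (max_modulus f x)) <= C + rho * ln (r k) + ln (ln x).
Proof.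
have [X hX] := max_modulus_ge_expR1.
set N := ((\sum_(0 <= j < K) n j + 2))%N.
(* For x >= 1 + 1/r_0 one has 1 + x/r_0 <= x^2, so log M is at most 2 log x times the sum of the
   n_j, plus 2. That sum is at most 2 N r_k^rho, and the final 2 is absorbed because r_k^rho log x
   >= 1. *)
pose C : R := 4 * N%:R + 2.
have e1 : 0 < expR 1 :> R := expR_gt0 _.
have i0 : 0 < (r 0%N)^-1 by rewrite invr_gt0.
exists (ln C), (`|X| + expR 1 + 1 + (r 0%N)^-1) => k x Kk /andP[rx xr] xX.
have X0 := normr_ge0 X; have XX := ler_norm X.
have x1 : 1 + (r 0%N)^-1 <= x by lra.
have xe : expR 1 <= x by lra.
have x0 : 0 < x by lra.
have L1 : 1 <= ln x by rewrite -(expRK 1) ler_ln ?posrE.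
have rk1 := r1 Kk; have rk0 := r0 k.
have p1 : 1 <= r k `^ rho.
  by rewrite -(powRr0 (r k)) ler_powR // ltW.
have C0 : 0 < C by rewrite /C ltr_wpDl // mulr_ge0.
have eM : expR 1 <= max_modulus f x by apply: hX; lra.
have M0 : 0 < max_modulus f x by lra.
have lM1 : 1 <= ln (max_modulus f x) by rewrite -[leLHS]expRK ler_ln ?posrE.
have lM : ln (max_modulus f x) <= C * r k `^ rho * ln x.
  apply: le_trans (_ : _ <= (\sum_(0 <= j < k.+1) n j)%:R * (2 * ln x) + 2) _.
    have y0 : 0 < 1 + x / r 0%N by rewrite ltr_wpDr // divr_ge0 // ltW.
    rewrite -[leRHS]expRK ler_ln ?posrE ?expR_gt0 // expRD.
    apply: le_trans (max_modulus_le (ltW x0) _) _.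
      by move=> z zx; apply: (cmod_f_le Kk _ zx); rewrite xr ltW.
    rewrite ler_wpM2r ?expR_ge0 // expRM_natl lerXn2r ?nnegrE ?expR_ge0 ?(ltW y0) //.
    rewrite (expRM_natl 2) lnK ?posrE //.
    have : (1 + (r 0%N)^-1) * x <= x * x by rewrite ler_pM2r.
    by rewrite mulrDl mul1r [_^-1 * x]mulrC expr2; lra.
  have hN : (\sum_(0 <= j < k.+1) n j)%:R <= N%:R * (2 * r k `^ rho) :> R.
    apply: le_trans (_ : _ <= (N * n k)%:R) _; first by rewrite ler_nat;
      exact: sum_n_le_mul.
    by rewrite natrM ler_wpM2l // n_le.
  have := ler_wpM2r (_ : 0 <= 2 * ln x) hN; move=> /(_ ltac:(lra)) h.
  have : 1 * 1 <= r k `^ rho * ln x by rewrite ler_pM.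
  by rewrite /C; move: h; nra.
rewrite -ln_powR -lnM ?posrE ?powR_gt0 // -lnM ?posrE ?mulr_gt0 ?powR_gt0 //; last by lra.
rewrite ler_ln ?posrE ?mulr_gt0 ?powR_gt0 //; lra.
Qed.

Lemma order_f : order_of_growth f = rho%:E.
Proof.
apply: (@limf_esup_pinfty _ (fun x => ln (ln (max_modulus f x)) / ln x)) => [e e0|e X e0].
  have [C [X hX]] := lnln_max_modulus_le.
  have [Y hY] := affine_ln_le C ltr01 e0.
  exists (`|X| + r K + expR 1 + expR Y) => x xX.
  have X0 := normr_ge0 X; have XX := ler_norm X; have rK := r0 K.
  have e1 : 0 < expR 1 :> R := expR_gt0 _; have eY := expR_gt0 Y.
  have x0 : 0 < x by lra.
  have L1 : 1 <= ln x by rewrite -(expRK 1) ler_ln ?posrE //; lra.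
  have LY : Y <= ln x by rewrite -(expRK Y) ler_ln ?posrE //; lra.
  have [|k Kk /andP[kx xk]] := @radius_bracket x; first by lra.
  have := hX k x Kk; rewrite kx (ltW xk) => /(_ isT) h.
  have {}h := h ltac:(lra); have := hY _ LY ltac:(lra).
  have lr : rho * ln (r k) <= rho * ln x by rewrite ler_wpM2l ?(ltW rho0) //
    ler_ln ?posrE.
  rewrite ler_pdivrMr; lra.
(* Room for two losses: n_k >= r_k^rho / 2, and the evaluation at 8 r_k instead of r_k. *)
pose T := (ln 2 + rho * ln 8) / e.
have [k Kk hk] := radius_unbounded (`|X| + expR T).
have X0 := normr_ge0 X; have XX := ler_norm X; have eT := expR_gt0 T; have rk := r0 k.
exists (8 * r k); first by lra.
have nk0 : 0 < (n k)%:R :> R by rewrite ltr0n.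
have l8 : 0 <= ln (8 : R) by rewrite ln_ge0 //; lra.
have hl : ln 2 + rho * ln 8 <= ln (r k) * e.
  by rewrite -ler_pdivrMr // -/T -[T]expRK ler_ln ?posrE //; lra.
have h1 : (n k)%:R <= ln (max_modulus f (8 * r k)).
  rewrite -[leLHS]expRK ler_ln ?posrE ?expR_gt0 ?max_modulus_at_8r //.
  exact: lt_le_trans (expR_gt0 _) (max_modulus_at_8r Kk).
have h2 : ln (n k)%:R <= ln (ln (max_modulus f (8 * r k))).
  by rewrite ler_ln ?posrE //; exact: lt_le_trans h1.
have h3 : rho * ln (r k) <= ln 2 + ln (n k)%:R.
  by rewrite -ln_powR -lnM ?posrE // ler_ln ?posrE ?powR_gt0 ?mulr_gt0 // n_ge.
have h4 : 0 <= e * ln 8 by rewrite mulr_ge0 ?(ltW e0).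
have h5 : 0 < ln (r k).
  have l2 : 0 < ln (2 : R) by rewrite -ln1 ltr_ln ?posrE //; lra.
  have h : 0 < ln (r k) * e by apply: lt_le_trans hl; rewrite ltr_pwDl //
    mulr_ge0 ?(ltW rho0).
  by move: h; rewrite pmulr_lgt0.
rewrite ler_pdivlMr lnM ?posrE //; lra.
Qed.

Lemma lower_order_f : lower_order_of_growth f = 0%:E.
Proof.
apply: (@limf_einf_pinfty _ (fun x => ln (ln (max_modulus f x)) / ln x)) => [e e0|e X e0].
  have [X hX] := max_modulus_ge_expR1.
  exists (`|X| + 1) => x xX; have X0 := normr_ge0 X; have XX := ler_norm X.
  have h : expR 1 <= max_modulus f x by apply: hX; lra.
  apply: le_trans (_ : _ <= 0) _; first by lra.
  rewrite divr_ge0 ?ln_ge0 //; last by lra.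
  rewrite -[leLHS]expRK ler_ln ?posrE ?expR_gt0 //.
  exact: lt_le_trans (expR_gt0 _) h.
have [C [X' hX']] := lnln_max_modulus_le.
(* At x = exp(r_k), ln (ln x) is ln r_k as well: hence the coefficient [rho + 1], to be beaten by ln
   x = r_k. *)
have [|Y hY] := @affine_ln_le _ C (rho + 1) e _ e0; first by have := rho0; lra.
have [k Kk hk] := radius_unbounded (`|X| + `|X'| + `|Y|).
have X0 := normr_ge0 X; have XX := ler_norm X; have Y0 := normr_ge0 Y;
  have YY := ler_norm Y.
have X'0 := normr_ge0 X'; have XX' := ler_norm X'; have rk := r0 k.
have ex := expR_ge1Dx (r k).
exists (expR (r k)); first by lra.
have := hX' k (expR (r k)) Kk; rewrite expo // andbT => /(_ ltac:(lra) ltac:(lra)).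
have := hY (r k) ltac:(lra) rk; rewrite expRK ler_pdivrMr //; lra.
Qed.

End Growth.

(** * The zeros as a sequence *)

(** The nonzero limit required by [infprod_cvg_to] confines any vanishing to the finitely many
    removed factors. *)
Lemma infprod_zero (R : realType) (a : nat -> R[i]) (p : R[i]) :
  infprod_cvg_to a p -> (p = 0 <-> exists m, a m = 0).
Proof.
move=> ap; have := infprod_cvg_prod ap => cv; split=> [p0|[m am]].
  case: ap => N [q [q0 _ pE]]; move: p0; rewrite pE => /eqP.
  rewrite mulf_eq0 (negbTE q0) orbF prodf_seq_eq0 => /hasP[m _ /eqP am].
  by exists m.
apply/eqP; rewrite -cmod_eq0 eq_le cmod_ge0 andbT.
apply: (cmod_cvg_le _ cv); exists m.+1 => // k /= mk.
suff /eqP -> : \prod_(0 <= i < k) a i == 0 by rewrite cmod0.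
rewrite prodf_seq_eq0; apply/hasP; exists m; last by rewrite am eqxx.
by rewrite mem_index_iota mk.
Qed.

Lemma nneseries_lt_pinfty (R : realType) (u : nat -> R) (B : R) :
  (forall m, 0 <= u m) -> (forall m, \sum_(0 <= i < m) u i <= B) ->
  (\sum_(0 <= m <oo) (u m)%:E < +oo)%E.
Proof.
move=> u0 uB; apply: (@le_lt_trans _ _ B%:E); last exact: ltry.
apply: lime_le; first by apply: is_cvg_nneseries => k _ _; rewrite lee_fin.
by apply: nearW => m; rewrite sumEFin lee_fin.
Qed.

(** From [K] on the terms are at most 2 r_i^(rho - s), which decays geometrically with ratio 64^(rho
    - s) < 1. The case s = 1 gives the product over the zeros, a smaller s the exponent of
    convergence. *)
Lemma sum_powers_bounded (R : realType) (rho s : R) (r : nat -> R) (n : nat -> nat)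
  (K : nat) :
  rho < s -> (forall k, 0 < r k) -> (forall k, (K <= k)%N -> 64 * r k <= r k.+1) ->
  (forall k, (K <= k)%N -> (n k)%:R <= 2 * r k `^ rho) ->
  exists B, forall k, \sum_(0 <= i < k) (n i)%:R * r i `^ (- s) <= B.
Proof.
move=> rs r0 ratio n_le; pose q : R := 64 `^ (rho - s).
have t0 i : 0 <= (n i)%:R * r i `^ (- s) by rewrite mulr_ge0 ?powR_ge0.
have q1 : q < 1.
  have l64 : 0 < ln (64 : R) by rewrite ln_gt0 //; lra.
  by rewrite /q /powR gt_eqF // expR_lt1 pmulr_llt0 // subr_lt0.
pose a i := r i `^ (rho - s).
have aS i : (K <= i)%N -> a i.+1 <= q * a i.
  move=> Ki; rewrite /a /q -powRM //; last exact/ltW.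
  rewrite -opprB !powRN lef_pV2 ?posrE ?powR_gt0 ?mulr_gt0 ?r0 //.
  by rewrite ge0_ler_powR ?nnegrE ?mulr_ge0 ?(ltW (r0 _)) ?ratio //; lra.
have a0 i : 0 <= a i by exact: powR_ge0.
exists (\sum_(0 <= i < K) (n i)%:R * r i `^ (- s) + 2 * (a K / (1 - q))) => k.
have [kK|/ltnW Kk] := leqP k K.
  rewrite [X in _ <= X + _](@big_cat_nat _ _ _ k) //= -addrA lerDl addr_ge0 ?sumr_ge0 //.
  by rewrite mulr_ge0 // divr_ge0 //; lra.
rewrite (@big_cat_nat _ _ _ K) //= lerD2l.
apply: le_trans (_ : _ <= \sum_(K <= i < k) 2 / (1 - q) * (a i - a i.+1)) _.
  apply: ler_sum_nat => i /andP[Ki _].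
  apply: le_trans (_ : _ <= 2 * a i) _.
    rewrite /a powRD; last by rewrite (gt_eqF (r0 i)) implybT.
    by rewrite mulrA ler_wpM2r ?powR_ge0 // n_le.
  rewrite -mulrA ler_wpM2l // mulrC ler_pdivlMr; last by lra.
  by have := aS _ Ki; lra.
rewrite -mulr_sumr.
under eq_bigr do rewrite -opprB; rewrite sumrN telescope_sumr //
  opprB -mulrA ler_wpM2l //.
by rewrite mulrC ler_wpM2r ?invr_ge0; [|lra|rewrite lerBlDr lerDl].
Qed.

Lemma derive1_is_derive (R : realType) (f f1 : R[i] -> R[i]) :
  (forall z : R[i], is_derive z 1 f (f1 z)) -> derive1 f = f1.
Proof. by move=> h; apply/funext => z; rewrite derive1E; exact: derive_val. Qed.

Section ZeroSequence.
Variables (R : realType) (r : nat -> R) (n : nat -> nat).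
Hypothesis r0 : forall k, 0 < r k.
Hypothesis rinc : forall k, r k < r k.+1.
Hypothesis n0 : forall k, (0 < n k)%N.
Local Notation zs := (zeros r n0).

Lemma block_ge k m : (block_start n k <= m)%N -> (k <= block n0 m)%N.
Proof.
move=> km; rewrite leqNgt; apply/negP => h.
by have := block_start_mono n h; have := block_bounds n0 m; lia.
Qed.

Lemma cmod_zeros_cvgy : r k @[k --> \oo] --> +oo -> cmod (zs m) @[m --> \oo] --> +oo.
Proof.
move=> /cvgryPge rlim; apply/cvgryPge => A.
have [k _ hk] := rlim A; exists (block_start n k) => // m /= km.
by rewrite cmod_zeros //; apply: hk; exact: block_ge.
Qed.

Lemma sum_zeros_bounded (h : R -> R) B : (forall x, 0 <= x -> 0 <= h x) ->
  (forall k, \sum_(0 <= i < k) (n i)%:R * h (r i) <= B) ->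
  forall m, \sum_(0 <= i < m) h (cmod (zs i)) <= B.
Proof.
move=> h0 hB m; apply: le_trans (hB m); rewrite -(zeros_sum r0 n0).
rewrite [leRHS](@big_cat_nat _ _ _ m) //= ?block_start_ge // lerDl sumr_ge0 // => i _.
exact/h0/cmod_ge0.
Qed.

(** [B] makes the product over the zeros converge; its limit is then read off along the block ends,
    where it coincides with the product over circles. *)
Lemma infprod_zeros B z p : (forall k, \sum_(0 <= i < k) (n i)%:R * (r i)^-1 <= B) ->
  infprod_cvg_to (fun k => 1 - (z / (r k)%:C) ^+ n k) p ->
  infprod_cvg_to (fun m => 1 - z / zs m) p.
Proof.
move=> hB hp; have [|q hq] := @infprod_summable _ (fun m => z / zs m) (cmod z * B).
  move=> m; under eq_bigr do rewrite cmodM cmodV.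
  rewrite -mulr_sumr ler_wpM2l ?cmod_ge0 //.
  by apply: (@sum_zeros_bounded (fun x => x^-1)) => // x; rewrite invr_ge0.
suff -> : p = q by [].
have Soo : block_start n k @[k --> \oo] --> \oo.
  move=> A [N _ hN]; exists N => // k /= Nk; apply: hN => /=.
  exact: leq_trans Nk (block_start_ge n0 k).
have h1 := infprod_cvg_prod hp; have h2 := cvg_comp _ _ Soo (infprod_cvg_prod hq).
apply: (cvg_unique (@complex_hausdorff R) h1); move: h2.
by under [X in X @ _]eq_fun do rewrite /comp zeros_prod.
Qed.

End ZeroSequence.

(** * Consequences of the growth condition, and the conclusion *)

Lemma eventual_growth (R : realType) (rho : R) (r : nat -> R) (n : nat -> nat) :
  0 < rho < 1 -> (forall k, 0 < r k) -> r k @[k --> \oo] --> +oo ->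
  (n k)%:R / r k `^ rho @[k --> \oo] --> (1 : R) ->
  (\forall k \near \oo, expR (r k) + 64 `^ rho^-1 * r k <= r k.+1) ->
  exists K, forall k, (K <= k)%N ->
    [/\ 64 * r k <= r k.+1, expR (r k) <= r k.+1, 1 <= r k,
        r k `^ rho <= 2 * (n k)%:R /\ (n k)%:R <= 2 * r k `^ rho &
        (2 * n k <= n k.+1)%N].
Proof.
move=> /andP[rho0 rho1] r0 /cvgryPge /(_ 1) [K1 _ h1] /cvgrPdist_le /(_ 2^-1).
move=> /(_ ltac:(by rewrite invr_gt0)) [K2 _ h2] [K3 _ h3].
have bnd k : (K2 <= k)%N -> r k `^ rho <= 2 * (n k)%:R /\ (n k)%:R <= 2 * r k `^ rho.
  move=> Kk; have p0 : 0 < r k `^ rho := powR_gt0 _ (r0 k).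
  have := h2 k Kk; rewrite /= ler_norml => /andP[].
  have -> : (n k)%:R = (n k)%:R / r k `^ rho * r k `^ rho :> R by rewrite divfK // gt_eqF.
  rewrite mulfK ?gt_eqF //; move: (_ / _) => y y1 y2; split; nra.
have h64 : 64 <= 64 `^ rho^-1 :> R.
  by rewrite le1r_powR ?ler1n // invf_ge1 // ltW.
exists (maxn K1 (maxn K2 K3)) => k; rewrite !geq_max => /and3P[k1 k2 k3].
have hk := h3 k k3; rewrite /= in hk; have rk := r0 k; have ek := expR_gt0 (r k).
have q : 64 * r k <= 64 `^ rho^-1 * r k by rewrite ler_wpM2r // ltW.
have [b1 b2] := bnd k k2; have [c1 c2] := bnd k.+1 (leqW k2).
split => //; [lra|lra|exact: (h1 k k1)|].
(* Raising to the power rho turns 64^(1/rho) into 64; with an error factor 2 on each side of n_k ~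
   r_k^rho this still gives n_(k+1) >= 16 n_k. *)
have h : (64 `^ rho^-1 * r k) `^ rho <= r k.+1 `^ rho.
  rewrite ge0_ler_powR ?nnegrE ?mulr_ge0 ?powR_ge0 ?(ltW (r0 _)) ?(ltW rho0) //; lra.
move: h; rewrite powRM ?powR_ge0 ?(ltW rk) // -powRrM mulVf ?gt_eqF // powRr1 // => h.
rewrite -(ler_nat R) natrM; lra.
Qed.

Lemma ler_term_sum (R : realType) (v : nat -> R) m M :
  (forall i, 0 <= v i) -> (m < M)%N -> v m <= \sum_(0 <= i < M) v i.
Proof.
move=> v0 mM; rewrite (bigD1_seq m) ?mem_index_iota ?iota_uniq //=.
by rewrite lerDl sumr_ge0.
Qed.

(* Sequences indexed by the positive integers are indexed here from 0.
   "(r_k) tends to infinity sufficiently fast" is: r_(k+1) >= Phi(r_k) for all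
   large k, where the growth function Phi depends on rho only. *)
Theorem theorem1p2 (R : realType) (rho : R) (hrho : 0 < rho < 1) :
  exists Phi : R -> R,
  forall (r : nat -> R) (n : nat -> nat),
    (forall k, 0 < r k) ->
    (forall k, r k < r k.+1) ->
    r k @[k --> \oo] --> +oo ->
    (forall k, (0 < n k)%N) ->
    (n k)%:R / r k `^ rho @[k --> \oo] --> (1 : R) ->
    (\forall k \near \oo, Phi (r k) <= r k.+1) ->
  exists f : R[i] -> R[i],
    (forall z, infprod_cvg_to (fun k => 1 - (z / (r k)%:C) ^+ n k) (f z)) /\
    entire f /\
    order_of_growth f = rho%:E /\
    lower_order_of_growth f = 0%:E /\
    exists zs : nat -> R[i],
      [/\ injective zs,
          (forall w, f w = 0 <-> exists m, zs m = w),
          (forall m, zs m != 0),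
          cmod (zs m) @[m --> \oo] --> +oo
        & (exponent_of_convergence zs < 1%:E)%E] /\
      (forall z, infprod_cvg_to (fun m => 1 - z / zs m) (f z)) /\
      (forall m, derive1 f (zs m) != 0) /\
      exists C : R, 0 < C /\
        forall m, cmod (derive1n 2 f (zs m) / derive1 f (zs m) ^+ 2) <= C.
Proof.
(* exp yields lower order 0; the linear term yields r_(k+1) >= 64 r_k and
   r_(k+1)^rho >= 64 r_k^rho, so that n_k eventually at least doubles. *)
exists (fun x => expR x + 64 `^ rho^-1 * x) => r n r0 rinc rlim n0 nlim rfast.
have [K hK] := eventual_growth hrho r0 rlim nlim rfast.
have [rho0 rho1] := andP hrho.
have ratio k : (K <= k)%N -> 64 * r k <= r k.+1 by move=> /hK[].
have expo k : (K <= k)%N -> expR (r k) <= r k.+1 by move=> /hK[].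
have r1 k : (K <= k)%N -> 1 <= r k by move=> /hK[].
have n_ge k : (K <= k)%N -> r k `^ rho <= 2 * (n k)%:R by move=> /hK[_ _ _ []].
have n_le k : (K <= k)%N -> (n k)%:R <= 2 * r k `^ rho by move=> /hK[_ _ _ []].
have n_double k : (K <= k)%N -> (2 * n k <= n k.+1)%N by move=> /hK[].
have [f [f1 [f2 [fP df df1 cv1 cv2]]]] :=
  product_entire r0 (sum_terms_bounded r0 rinc n0 ratio rlim).
have f'E : derive1 f = f1 := derive1_is_derive df.
have f''E : derive1n 2 f = f2.
  by rewrite -(derive1_is_derive df1) -f'E.
pose zs := zeros r n0.
have [B hB] := sum_powers_bounded rho1 r0 ratio n_le.
have {}hB k : \sum_(0 <= i < k) (n i)%:R * (r i)^-1 <= B.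
  apply: le_trans (hB k); apply: ler_sum => i _.
  by rewrite powR_inv1 // ltW.
have zP z : infprod_cvg_to (fun m => 1 - z / zs m) (f z).
  exact: (infprod_zeros r0 n0 hB (fP z)).
(* Besides simplicity of the zeros, this licenses the passage to the limit in the quotients
   below. *)
have f'_neq0 m : f1 (zs m) != 0.
  have [c c0 hc] := deriv_product_at_zero_gt0 r0 rinc n0 ratio (zeros_neq0 r0 n0 m)
    (cmod_zeros r0 n0 m) (zeros_root r0 n0 m).
  rewrite -cmod_gt0; apply: lt_le_trans c0 _.
  exact: (cmod_cvg_ge _ (cv1 (zs m)) hc).
exists f; split; first exact: fP.
split; first by move=> z; have [] := df z.
split; first exact: (order_f rho0 r0 rinc rlim n0 ratio r1 n_ge n_le n_double fP).
split; first exact: (lower_order_f rho0 r0 rinc rlim n0 ratio expo r1 n_le n_double fP).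
exists zs; split; [split|split; [exact: zP|split]].
- exact: zeros_inj.
- move=> w; rewrite (infprod_zero (zP w)); split=> -[m hm]; exists m.
    apply/eqP; rewrite eq_sym; move/eqP: hm; rewrite subr_eq0 => /eqP hm.
    by rewrite -[zs m]mul1r hm divfK // zeros_neq0.
  by rewrite hm divff ?subrr // -hm zeros_neq0.
- exact: zeros_neq0.
- exact: cmod_zeros_cvgy.
(* The midpoint of rho and 1 is an admissible exponent below 1. *)
- pose t := (1 + rho) / 2.
  have [|B' hB'] := @sum_powers_bounded _ rho t r n K _ r0 ratio n_le.
    by rewrite /t; lra.
  apply: (@le_lt_trans _ _ t%:E); last by rewrite lte_fin /t; lra.
  apply: ge_ereal_inf; exists t%:E => //; exists t => //; split; first by rewrite /t; lra.
  apply: (@nneseries_lt_pinfty _ _ B') => [m|]; first exact: powR_ge0.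
  apply: (@sum_zeros_bounded _ _ _ r0 n0 (fun x => x `^ (- t))) => // x _.
  exact: powR_ge0.
- by move=> m; rewrite f'E.
rewrite f'E f''E.
(* [N] comes from [sum_n_le_mul]; [D] is the bound of [ratio_at_zero] for C = 2N + 1, since 2 N n_k
   + 1 <= (2N + 1) n_k. *)
pose N := (\sum_(0 <= j < K) n j + 2)%N.
pose D : R := 2 * (1 + 2 * (2 * N%:R + 1)).
pose v m := cmod (f2 (zs m) / f1 (zs m) ^+ 2).
have v0 m : 0 <= v m := cmod_ge0 _.
(* Beyond [M] the circle has index at least K + 1, so the ratio condition applies to the preceding
   circle and all inner radii are at most half of r_k. The finitely many earlier quotients are
   bounded by their sum. *)
pose M := block_start n K.+1.
have D0 : 0 < D by rewrite /D; have := ler0n R N; lra.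
exists (D + \sum_(0 <= m < M) v m); split; first by rewrite ltr_wpDr ?sumr_ge0.
move=> m; rewrite -/(v m); have [mM|Mm] := ltnP m M.
  by apply: le_trans (ler_term_sum v0 mM) _; rewrite lerDr ltW.
apply: le_trans (_ : _ <= D) _; last by rewrite lerDl sumr_ge0.
have hk := block_ge n0 Mm; set k := block n0 m in hk *.
have cv : (partial_product r n l)^`(2).[zs m] / (partial_product r n l)^`().[zs m] ^+ 2
    @[l --> \oo] --> f2 (zs m) / f1 (zs m) ^+ 2.
  apply: cvgM; first exact: cv2.
  apply: cvgV; first by rewrite expf_neq0.
  by rewrite expr2; apply: cvgM; exact: cv1.
apply: (cmod_cvg_le _ cv); exists k.+1 => // l /= kl.
apply: (ratio_at_zero r0 rinc n0 ratio _ kl); rewrite ?cmod_zeros ?zeros_root //.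
- exact: ltnW.
- move=> j jk; case: k hk jk {kl} => // k hk jk.
  have h1 := radius_mono rinc (jk : (j <= k)%N); have := ratio k hk; have := r0 k; lra.
- have := sum_n_le_mul n0 n_double (ltnW hk); rewrite big_nat_recr //= -/N => h.
  have h' : (\sum_(0 <= j < k) n j)%:R <= N%:R * (n k)%:R :> R.
    by rewrite -natrM ler_nat (leq_trans _ h) // leq_addr.
  have n1 : 1 <= (n k)%:R :> R by rewrite ler1n.
  lra.
Qed.
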